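(* Let $\mathcal W\subset\mathbb R^d$ be a nonempty compact convex set, $B:=\sup_{w\in\mathcal W}\|w\|_\infty$ and $\mathcal D=\{x\in\mathbb R^d:\|x\|_\infty\le B\}$. Let $G>0$ and let the losses $f_t$ be differentiable, $H$-strongly convex in $L_2$ norm on $\mathcal D$, with $\|\nabla f_t(x)\|_\infty\le G$ for all $x\in\mathcal D$. Let $\mathcal A$ be the algorithm of the coordinate-wise FLH-OGD construction (Corollary 1) on $\mathcal D$ with $G_\infty=2G$. Consider the scheme: at round $t$ obtain $x_t\in\mathcal D$ from $\mathcal A$, play $\hat x_t=\Pi_{\mathcal W}(x_t)\in\arg\min_{y\in\mathcal W}\|x_t-y\|_1$, observe $f_t$, and feed $\mathcal A$ the surrogate loss $\ell_t(x)=f_t(x)+G\,S(x)$ with $S(x)=\|x-\Pi_{\mathcal W}(x)\|_1$ (using its subgradients). Then for every $C_n\ge 0$ and every comparator sequence $w_1,\dots,w_n\in\mathcal W$ with $\sum_{t=2}^n\|w_t-w_{t-1}\|_1\le C_n$, $$\sum_{t=1}^n f_t(\hat x_t)-f_t(w_t)=\tilde O\big(d^{1/3}n^{1/3}C_n^{2/3}\vee d\big),$$ where $\tilde O$ hides constants and factors depending on $\log n$, $H$, $G$, $B$.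
   Context: Coordinate-wise FLH-OGD (Corollary 1) for $H$-strongly convex losses $g_t$ on $\mathcal D$ with $\|\nabla g_t\|_\infty\le G_\infty$ (gradients may be subgradients): run $d$ independent instances of univariate FLH-OGD with decision set $[-B,B]$ and learning rate $\zeta=1/(2(2B+G_\infty/H)^2)$; instance $i$ outputs $x_t[i]$ and receives the squared loss $x\mapsto\big(x-(x_t[i]-\nabla g_t(x_t)[i]/H)\big)^2$. Univariate FLH-OGD on squared losses $x\mapsto(y_t-x)^2$: for each $j$ a base learner started at time $j$ runs projected OGD on $[-B,B]$ from a fixed start point with $x^{(j)}_{t+1}=\Pi(x^{(j)}_t-\frac{1}{2\tau}2(x^{(j)}_t-y_t))$, $\tau=t-j+1$; the FLH meta-algorithm keeps weights $v_t$, $v_1=(1)$, predicts $x_t=\sum_{j\le t}v^{(j)}_tx^{(j)}_t$, updates $\hat v^{(i)}_{t+1}\propto v^{(i)}_te^{-\zeta(y_t-x^{(i)}_t)^2}$ ($i\le t$, normalized), $v^{(t+1)}_{t+1}=1/(t+1)$, $v^{(i)}_{t+1}=(1-\frac1{t+1})\hat v^{(i)}_{t+1}$. $a\vee b=\max\{a,b\}$. *)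

(* Defs.v *)
From HB Require Import structures.
From mathcomp Require Import all_boot all_order all_algebra.
From mathcomp Require Import all_classical all_reals all_analysis.
Set Implicit Arguments. Unset Strict Implicit. Unset Printing Implicit Defensive.
Import Order.TTheory GRing.Theory Num.Theory.
Import numFieldNormedType.Exports.
Local Open Scope classical_set_scope.
Local Open Scope ring_scope.

Section Defs.
Variable R : realType.

Definition linf {d} (x : 'rV[R]_d) : R := \big[Num.max/0]_(i < d) `|x ord0 i|.
Definition l1 {d} (x : 'rV[R]_d) : R := \sum_(i < d) `|x ord0 i|.
Definition l2sq {d} (x : 'rV[R]_d) : R := \sum_(i < d) (x ord0 i) ^+ 2.
Definition dotp {d} (x y : 'rV[R]_d) : R := \sum_(i < d) x ord0 i * y ord0 i.

Definition box d (B : R) : set 'rV[R]_d := [set x | linf x <= B].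

Definition convex_set_rV d (W : set 'rV[R]_d) : Prop :=
  forall x y (l : R), W x -> W y -> 0 <= l <= 1 -> W (l *: x + (1 - l) *: y).

Definition grad d (f : 'rV[R]_d -> R) (x : 'rV[R]_d) : 'rV[R]_d :=
  \row_(i < d) ('D_(delta_mx ord0 i) f x : R).

Definition strongly_convex_on d (H : R) (D : set 'rV[R]_d) (f : 'rV[R]_d -> R) :=
  forall x y, D x -> D y ->
    f x + dotp (grad f x) (y - x) + H / 2 * l2sq (y - x) <= f y.

Definition is_l1_proj d (W : set 'rV[R]_d) (P : 'rV[R]_d -> 'rV[R]_d) :=
  forall x, W (P x) /\ forall y, W y -> l1 (x - P x) <= l1 (x - y).

Definition Spen d (P : 'rV[R]_d -> 'rV[R]_d) (x : 'rV[R]_d) : R := l1 (x - P x).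

Definition is_subgrad d (h : 'rV[R]_d -> R) (x g : 'rV[R]_d) :=
  forall y, h x + dotp g (y - x) <= h y.

(* ---------- univariate FLH-OGD on squared losses x |-> (y - x)^2 ---------- *)
(* state at time t: positions upos j of base learners j = 1..t (learner j started at
   time j) and meta-weights uw j. *)
Record ustate := USt { upos : nat -> R; uw : nat -> R }.

Definition clamp (B x : R) : R := Num.max (- B) (Num.min B x).

Definition upred (t : nat) (s : ustate) : R :=
  \sum_(1 <= j < t.+1) uw s j * upos s j.

Definition uinit (x0 : R) : ustate :=
  USt (fun _ => x0) (fun j => if j == 1%N then 1 else 0).

Definition uupd (B zeta x0 : R) (t : nat) (s : ustate) (y : R) : ustate :=
  let Z := \sum_(1 <= k < t.+1) uw s k * expR (- zeta * (y - upos s k) ^+ 2) in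
  USt (fun j => if (j <= t)%N then
                  clamp B (upos s j - 1 / (2 * ((t - j).+1)%:R) * (2 * (upos s j - y)))
                else x0)
      (fun j => if (j <= t)%N then
                  (1 - 1 / (t.+1)%:R) * (uw s j * expR (- zeta * (y - upos s j) ^+ 2) / Z)
                else if j == t.+1 then 1 / (t.+1)%:R else 0).

(* fb t x = (sub)gradient of the loss g_t at the point x_t = x that is fed back.
   zeta = 1/(2(2B + Ginf/H)^2); instance i receives y_t[i] = x_t[i] - fb t x_t [i] / H. *)
Definition cw_zeta (B Ginf H : R) : R := 1 / (2 * (2 * B + Ginf / H) ^+ 2).

Definition cw_pred d (t : nat) (s : 'I_d -> ustate) : 'rV[R]_d :=
  \row_(i < d) upred t (s i).

(* cw_state k = state of the d instances at time k+1 *)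
Fixpoint cw_state d (B Ginf H : R) (x0 : 'rV[R]_d)
    (fb : nat -> 'rV[R]_d -> 'rV[R]_d) (k : nat) : 'I_d -> ustate :=
  match k with
  | 0 => fun i => uinit (x0 ord0 i)
  | k'.+1 =>
      let s := cw_state B Ginf H x0 fb k' in
      let x := cw_pred k'.+1 s in
      let g := fb k'.+1 x in
      fun i => uupd B (cw_zeta B Ginf H) (x0 ord0 i) k'.+1 (s i)
                    (x ord0 i - g ord0 i / H)
  end.

(* x_t, for t >= 1 *)
Definition cw_x d (B Ginf H : R) (x0 : 'rV[R]_d)
    (fb : nat -> 'rV[R]_d -> 'rV[R]_d) (t : nat) : 'rV[R]_d :=
  cw_pred t (cw_state B Ginf H x0 fb t.-1).

(* surrogate-loss gradient fed back: grad f_t (x) + G * s, s a subgradient of S at x *)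
Definition surr_fb d (G : R) (f : nat -> 'rV[R]_d -> R)
    (sg : nat -> 'rV[R]_d -> 'rV[R]_d) : nat -> 'rV[R]_d -> 'rV[R]_d :=
  fun t x => grad (f t) x + G *: sg t x.

Definition scheme_play d (B G H : R) (x0 : 'rV[R]_d) (f : nat -> 'rV[R]_d -> R)
    (P : 'rV[R]_d -> 'rV[R]_d) (sg : nat -> 'rV[R]_d -> 'rV[R]_d) (t : nat) : 'rV[R]_d :=
  P (cw_x B (2 * G) H x0 (surr_fb G f sg) t).

End Defs.

(* Main.v *)
Require Import Defs.
From HB Require Import structures.
From mathcomp Require Import all_boot all_order all_algebra.
From mathcomp Require Import all_classical all_reals all_analysis.
From mathcomp Require Import zify ring lra.
Set Implicit Arguments. Unset Strict Implicit. Unset Printing Implicit Defensive.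
Import Order.TTheory GRing.Theory Num.Theory.
Import numFieldNormedType.Exports.
Local Open Scope classical_set_scope.
Local Open Scope ring_scope.

(* Strong convexity reduces the regret to [d] univariate squared-loss regrets against
   [y_t = x_t - g_t / H]. For squared losses, FLH over OGD has logarithmic regret against
   constants on every interval. For the dynamic regret, replace the comparator by the
   least-squares optimum [u] over sequences in [[-B, B]] with the same total variation
   budget, and cut time greedily into bins of length [m] on which [u] has variation [v] with
   [m v^2 = O(1)]. On a bin there is a sequence [c] with at most five constant pieces, at
   distance [O(v)] from [u], such that moving [u] away from [c] does not increase the
   variation: if [u] is unimodal on the bin, [c] jumps to the peak; otherwise [u] has a valley,
   and [c] digs that valley [2 v] deeper, which outweighs all other oscillations of [u].
   Optimality of [u] kills the first-order term, so [c] loses at most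
   [sum (c - u)^2 = O(m v^2)] against [u] and every bin costs [O(log n)]. The number of bins is
   at most [1 + n / theta^2 + (theta + 3 / B) TV] for every [theta > 0]; the same [theta] serves
   all coordinates, and [theta = (d n / TV)^(1/3)] gives the rate. *)

(** * Total variation and coarsenings *)

Definition tvar (R : numDomainType) (u : nat -> R) (r s : nat) : R :=
  \sum_(r <= k < s) `|u k.+1 - u k|.

Lemma tvar_ge0 (R : numDomainType) (u : nat -> R) r s : 0 <= tvar u r s.
Proof. by apply: sumr_ge0. Qed.

Lemma tvar_cat (R : numDomainType) (u : nat -> R) r m s :
  (r <= m <= s)%N -> tvar u r s = tvar u r m + tvar u m s.
Proof. by case/andP=> rm ms; rewrite /tvar (big_cat_nat rm ms). Qed.

Lemma tvarN (R : numDomainType) (u : nat -> R) r s :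
  tvar (fun t => - u t) r s = tvar u r s.
Proof. by apply: eq_bigr => k _; rewrite -opprD normrN. Qed.

Lemma dist_le_tvar (R : realDomainType) (u : nat -> R) r s a b :
  (r <= a <= s)%N -> (r <= b <= s)%N -> `|u a - u b| <= tvar u r s.
Proof.
wlog ab : a b / (a <= b)%N => [hwlog ra rb|/andP[ra _] /andP[_ bs]].
  by have [ab|/ltnW ba] := leqP a b; [exact: hwlog|rewrite distrC; exact: hwlog].
apply: (@le_trans _ _ (tvar u a b)); last first.
  rewrite (@tvar_cat _ u r a s) ?ra ?(leq_trans ab bs)// (@tvar_cat _ u a b s) ?ab//.
  have := tvar_ge0 u r a; have := tvar_ge0 u b s; lra.
elim: b ab {bs} => [|b IH]; first by rewrite leqn0 => /eqP->; rewrite subrr normr0 tvar_ge0.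
rewrite leq_eqVlt => /predU1P[->|]; first by rewrite subrr normr0 tvar_ge0.
rewrite ltnS => ab; rewrite /tvar big_nat_recr//=.
by rewrite (le_trans (ler_distD (u b) _ _))// lerD ?IH// distrC.
Qed.

(* The one-sided derivative of [e |-> `|a + e * (a - b)|] at [e = 0]. *)
Definition dabs (R : numDomainType) (a b : R) : R :=
  if a == 0 then `|b| else `|a| - Num.sg a * b.

Lemma dabs_le (R : realDomainType) (a b : R) : dabs a b <= `|a| + `|b|.
Proof.
rewrite /dabs; case: eqVneq => [->|a0]; first by rewrite normr0 add0r.
rewrite lerD2l -mulNr; case: (sgrP a) a0 => //= _ _; rewrite ?opprK ?mul1r ?mulN1r.
- by rewrite -normrN ler_norm.
- by rewrite ler_norm.
Qed.

Lemma dabsN (R : realDomainType) (a b : R) : dabs (- a) (- b) = dabs a b.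
Proof. by rewrite /dabs oppr_eq0 !normrN sgrN mulrNN. Qed.

(** An exact identity, not only a first-order expansion: while the perturbation is at most [|a|] in
    size, [a + e * (a - b)] keeps the sign of [a], so its absolute value is affine in [e]; for
    [a = 0] every [e > 0] is allowed. *)
Lemma dabs_step (R : realFieldType) (a b e : R) :
  0 < e -> e * `|a - b| <= `|a| \/ a = 0 -> `|a + e * (a - b)| = `|a| + e * dabs a b.
Proof.
move=> e0 h; rewrite /dabs; case: eqVneq => [->|a0].
  by rewrite normr0 !add0r mulrN normrN normrM gtr0_norm.
have {}h : e * `|a - b| <= `|a| by case: h => // /eqP; rewrite (negbTE a0).
have h1 : `|e * (a - b)| <= `|a| by rewrite normrM gtr0_norm.
have : - `|a| <= e * (a - b) <= `|a| by rewrite -ler_norml.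
case: (sgrP a) a0 {h h1} => //= sa _ /andP[h1 h2].
- by rewrite ger0_norm; lra.
- by rewrite ler0_norm; lra.
Qed.

(* [u + e (u - c)] stays in the box and does not increase the total variation, to first
   order in [e]; so at a constrained least-squares optimum [u] the piecewise constant
   sequence [c] loses only the second-order term [sum (c - u)^2]. *)
Record coarsening (R : realFieldType) (B : R) (u : nat -> R) (r s : nat)
    (c : nat -> R) : Prop := Coarsening {
  coarsen_l : c r = u r;
  coarsen_r : c s = u s;
  coarsen_box : forall t, (r <= t <= s)%N -> `|c t| <= B;
  coarsen_dist : forall t, (r <= t <= s)%N -> `|c t - u t| <= 3 * tvar u r s;
  coarsen_bd : forall t, (r <= t <= s)%N -> `|u t| = B -> c t = u t;
  coarsen_tv : \sum_(r <= k < s) dabs (u k.+1 - u k) (c k.+1 - c k) <= 0;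
  coarsen_jumps : \sum_(r <= k < s) (c k.+1 != c k)%:R <= 4 :> R }.

Lemma coarseningN (R : realFieldType) (B : R) u r s c :
  coarsening B (fun t => - u t) r s c -> coarsening B u r s (fun t => - c t).
Proof.
case=> cl cr cb cd ce ct cj; split.
- by rewrite cl opprK.
- by rewrite cr opprK.
- by move=> t /cb; rewrite normrN.
- by move=> t /cd; rewrite tvarN opprK -opprD normrN.
- by move=> t /ce; rewrite normrN => h /h ->; rewrite opprK.
- rewrite (le_trans _ ct)// le_eqVlt; apply/orP; left; apply/eqP.
  by apply: eq_bigr => k _; rewrite -[in RHS]dabsN; congr dabs; ring.
- rewrite (le_trans _ cj)// le_eqVlt; apply/orP; left; apply/eqP.
  by apply: eq_bigr => k _; rewrite eqr_opp.
Qed.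

(** * Constructing a coarsening on a bin: valleys and unimodal stretches *)

Lemma exists_argmax (R : realDomainType) (u : nat -> R) r s : (r <= s)%N ->
  exists2 k, (r <= k <= s)%N & forall t, (r <= t <= s)%N -> u t <= u k.
Proof.
elim: s => [|s IH] rs.
  by exists 0%N => [|t /andP[_]]; [rewrite rs|rewrite leqn0 => /eqP->].
move: rs; rewrite leq_eqVlt => /predU1P[->|].
  by exists s.+1 => [|t]; [rewrite leqnn|rewrite -eqn_leq => /eqP->].
rewrite ltnS => /IH[k /andP[rk ks] kmax].
have [h|/ltW h] := leP (u s.+1) (u k).
  exists k => [|t /andP[rt]]; first by rewrite rk leqW.
  by rewrite leq_eqVlt => /predU1P[->//|]; rewrite ltnS => ts; apply: kmax; rewrite rt.
exists s.+1 => [|t /andP[rt]]; first by rewrite leqnn andbT (leq_trans rk) ?leqW.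
rewrite leq_eqVlt => /predU1P[->//|]; rewrite ltnS => ts.
by apply: le_trans h; apply: kmax; rewrite rt.
Qed.

(** If some ascent follows the first descent, shrink the pair (descent [i], ascent [j]): any strict
    change of [u] between them can replace [i] or [j], so an innermost pair encloses a flat floor.
    If none does, the first descent is the peak. *)
Lemma valley_or_unimodal (R : realDomainType) (u : nat -> R) r s : (r <= s)%N ->
  (exists i j, [/\ (r <= i)%N, (i < j < s)%N, u i.+1 < u i, u j < u j.+1 &
     forall k, (i < k <= j)%N -> u k = u i.+1]) \/
  (exists2 k, (r <= k <= s)%N &
     (forall j, (r <= j < k)%N -> u j <= u j.+1) /\
     (forall j, (k <= j < s)%N -> u j.+1 <= u j)).
Proof.
move=> rs.
have vmin m : forall i j, (j - i <= m)%N -> (r <= i)%N -> (i < j < s)%N ->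
    u i.+1 < u i -> u j < u j.+1 ->
    exists i j, [/\ (r <= i)%N, (i < j < s)%N, u i.+1 < u i, u j < u j.+1 &
     forall k, (i < k <= j)%N -> u k = u i.+1].
  elim: m => [|m IH] i j jim ri /andP[ij js] ui uj; first by lia.
  case: (boolP (has (fun k => u k.+1 != u k) (iota i.+1 (j - i.+1)))).
    case/hasP=> k; rewrite mem_iota subnKC// => /andP[ik kj].
    rewrite neq_lt => /orP[uk|uk].
      by apply: (IH k j) => //; lia.
    by apply: (IH i k) => //; lia.
  rewrite -all_predC => /allP h; exists i, j; split=> //; first by rewrite ij.
  elim=> // k IHk /andP[ik kj].
  move: ik; rewrite ltnS leq_eqVlt => /predU1P[->//|ik].
  have /negPn/eqP -> : ~~ (u k.+1 != u k).
    by apply: (h k); rewrite mem_iota subnKC// ik.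
  by rewrite IHk// ik ltnW.
case: (boolP (has (fun k => u k.+1 < u k) (iota r (s - r)))) => [hd|].
  set P := fun k => (r <= k < s)%N && (u k.+1 < u k).
  have exP : exists k, P k.
    by case/hasP: hd => k; rewrite mem_iota subnKC// => hk uk; exists k; rewrite /P hk.
  case: (ex_minnP exP) => k /andP[/andP[rk ks] uk] kmin.
  case: (boolP (has (fun j => u j < u j.+1) (iota k.+1 (s - k.+1)))) => [|].
    case/hasP=> j; rewrite mem_iota subnKC// => /andP[kj js] uj; left.
    by apply: (vmin (j - k)%N k j) => //; rewrite kj.
  rewrite -all_predC => /allP h; right; exists k; first by rewrite rk ltnW.
  split=> j /andP[rj jk].
    rewrite leNgt; apply/negP => uj.
    by have := kmin j; rewrite /P rj (ltn_trans jk ks) uj => /(_ isT); rewrite leqNgt jk.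
  move: rj; rewrite leq_eqVlt => /predU1P[<-|kj]; first exact: ltW.
  by rewrite leNgt; apply: (h j); rewrite mem_iota subnKC// kj.
rewrite -all_predC => /allP h; right; exists s; first by rewrite rs leqnn.
split=> j; last by rewrite leqNgt => /andP[/negbTE->].
by move=> rj; rewrite leNgt; apply: (h j); rewrite mem_iota subnKC.
Qed.

Lemma sum_nat_indic (R : pzRingType) r s a (x : R) : (r <= a < s)%N ->
  \sum_(r <= k < s) x * (k == a)%:R = x.
Proof.
move=> ras; rewrite (bigD1_seq a) ?mem_index_iota ?iota_uniq//= eqxx mulr1.
by rewrite big1 ?addr0// => k /negbTE ->; rewrite mulr0.
Qed.

(** Starting from a nonnegative value, a variation of at most [B / 3] cannot reach a negative [- B];
    only the upper wall of the box can be touched. *)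
Lemma norm_eq_bound_top (R : realFieldType) (B : R) (u : nat -> R) r s t :
  0 <= u r -> 3 * tvar u r s <= B -> (r <= t <= s)%N -> `|u t| = B -> u t = B.
Proof.
move=> ur vB /andP[rt ts] utB.
have /ler_normlP[h1 h2]: `|u t - u r| <= tvar u r s.
  by apply: dist_le_tvar; rewrite ?rt ?ts ?leqnn ?(leq_trans rt ts).
have B0 : 0 <= B by rewrite -utB normr_ge0.
have [u0|u0] := ltP (u t) 0; last by rewrite -utB ger0_norm.
by move: utB; rewrite ltr0_norm// => utB; lra.
Qed.

(** The oscillations of [u] contribute [v] to the derivative of the variation, the jumps next to the
    two endpoints at most [v] each, and each valley wall gains [2 * v]. The balance is
    [3 * v - 4 * v <= 0]. *)
Lemma coarsening_valley (R : realFieldType) (B : R) (u : nat -> R) r s i j :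
  (forall t, (r <= t <= s)%N -> `|u t| <= B) -> 3 * tvar u r s <= B -> 0 <= u r ->
  (r <= i)%N -> (i < j < s)%N -> u i.+1 < u i -> u j < u j.+1 ->
  (forall k, (i < k <= j)%N -> u k = u i.+1) -> exists c, coarsening B u r s c.
Proof.
move=> uB vB ur ri /andP[ij js] ui uj plat.
have rs : (r <= s)%N by lia.
have [m ms mmax] := exists_argmax u rs.
set v := tvar u r s in vB *.
have v0 : 0 <= v by exact: tvar_ge0.
have dv a b : (r <= a <= s)%N -> (r <= b <= s)%N -> `|u a - u b| <= v by exact: dist_le_tvar.
have ir : (r <= i.+1 <= s)%N by lia.
have rr : (r <= r <= s)%N by lia.
have ss : (r <= s <= s)%N by lia.
have low t : (r <= t <= s)%N -> - v <= u t.
  by move=> ht; have /ler_normlP[] := dv _ _ ht rr; lra.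
(* The maximum [u m] off the valley makes [c >= u] there, so both valley walls of [c] are higher
   than those of [u] by at least [2 * v]. The floor stays in the box: [u i.+1 >= - v], hence
   [u i.+1 - 2 * v >= - 3 * v >= - B]. *)
pose c t := if t == r then u r else if t == s then u s else
  if (i < t <= j)%N then u i.+1 - 2 * v else u m.
have cr : c r = u r by rewrite /c eqxx.
have cs : c s = u s by rewrite /c eqxx; case: eqP => // ->.
have cp t : (i < t <= j)%N -> c t = u i.+1 - 2 * v.
  move=> h; rewrite /c h; have /negbTE -> : t != r by lia.
  by have /negbTE -> : t != s by lia.
have cm t : t != r -> t != s -> ~~ (i < t <= j)%N -> c t = u m.
  by move=> /negbTE h1 /negbTE h2 /negbTE h3; rewrite /c h1 h2 h3.
have cge t : (r <= t <= s)%N -> ~~ (i < t <= j)%N -> u t <= c t.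
  move=> h1 h2; have [->|tr] := eqVneq t r; first by rewrite cr.
  have [->|ts] := eqVneq t s; first by rewrite cs.
  by rewrite cm// mmax.
have cdist t : (r <= t <= s)%N -> `|c t - u t| <= 3 * v.
  move=> ht; have [h|h] := boolP (i < t <= j)%N.
    by rewrite cp// (plat _ h) addrAC subrr add0r normrN ger0_norm; lra.
  have [->|tr] := eqVneq t r; first by rewrite cr subrr normr0; lra.
  have [->|ts] := eqVneq t s; first by rewrite cs subrr normr0; lra.
  by rewrite cm// (le_trans (dv _ _ ms ht))//; lra.
exists c; split=> //.
- move=> t ht; have [h|h] := boolP (i < t <= j)%N.
    rewrite cp//; have := low _ ir; have /ler_normlP[] := uB _ ir => h1 h2 h3.
    by apply/ler_normlP; split; lra.
  have [->|tr] := eqVneq t r; first by rewrite cr uB.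
  have [->|ts] := eqVneq t s; first by rewrite cs uB.
  by rewrite cm// uB.
(* The floor lies strictly below [u i <= B], so no point of it is on the wall; off the floor,
   [u t = B] forces the maximum [u m] to be [B] as well. *)
- move=> t ht /(norm_eq_bound_top ur vB ht) utB.
  have [h|h] := boolP (i < t <= j)%N.
    have iis : (r <= i <= s)%N by lia.
    by have := uB _ iis; rewrite ler_norml => /andP[_]; move: utB; rewrite plat//; lra.
  have [->|tr] := eqVneq t r; first by rewrite cr.
  have [->|ts] := eqVneq t s; first by rewrite cs.
  rewrite cm// utB; apply/eqP; rewrite eq_le -{2}utB mmax// andbT.
  by have := uB _ ms; rewrite ler_norml => /andP[].
(* The indicators locate the only places where [c] may jump: next to the endpoints, where a jump
   costs at most [v], and at the walls [i] and [j], where it follows the sign of the increment of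
   [u] and is therefore gained. *)
- have step k : (r <= k < s)%N -> dabs (u k.+1 - u k) (c k.+1 - c k) <=
      `|u k.+1 - u k| + (v * (k == r)%:R + v * (k == s.-1)%:R
        - 2 * v * (k == i)%:R - 2 * v * (k == j)%:R).
    move=> /andP[rk ks].
    have vr : 0 <= v * (k == r)%:R by rewrite mulr_ge0.
    have vs : 0 <= v * (k == s.-1)%:R by rewrite mulr_ge0.
    have [ki|ki] := eqVneq k i.
      subst k; have /negbTE -> : i != j by lia.
      rewrite /dabs subr_eq0 lt_eqF// ltr0_sg ?subr_lt0// cp ?ltnSn ?ij//.
      rewrite /= mulr1n mulr0n mulr1 mulr0.
      by have := cge i; rewrite rk (ltnW ks) ltnn => /(_ isT isT); lra.
    have [kj|kj] := eqVneq k j.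
      subst k; rewrite /dabs subr_eq0 gt_eqF// gtr0_sg ?subr_gt0//.
      rewrite [c j]cp ?ij ?leqnn//.
      rewrite /= mulr1n mulr0n mulr1 mulr0.
      have := cge j.+1; rewrite leqW//= js ltnn andbF => /(_ isT isT).
      have := plat j; rewrite ij leqnn => /(_ isT) <-; lra.
    rewrite /= mulr0n mulr0 !subr0; apply: le_trans (dabs_le _ _) _; rewrite lerD2l.
    have [h|h] := boolP (i < k < j)%N.
      rewrite !cp; [|lia|lia]; rewrite subrr normr0; lra.
    have h1 : ~~ (i < k <= j)%N by lia.
    have h2 : ~~ (i < k.+1 <= j)%N by lia.
    have [kr|kr] := eqVneq k r.
      subst k; rewrite cr cm//; [|lia|lia].
      by rewrite /= mulr1n mulr1 (le_trans (dv _ _ ms rr))//; lra.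
    have [kss|kss] := eqVneq k s.-1.
      have -> : k.+1 = s by lia.
      by rewrite cs cm//; [rewrite /= mulr1n mulr1 (le_trans (dv _ _ ss ms))//; lra|lia].
    by rewrite !cm//; [rewrite subrr normr0 /= !mulr0n; lra|lia|lia|lia].
  have : \sum_(r <= k < s) dabs (u k.+1 - u k) (c k.+1 - c k) <=
      \sum_(r <= k < s) (`|u k.+1 - u k| + (v * (k == r)%:R + v * (k == s.-1)%:R
        - 2 * v * (k == i)%:R - 2 * v * (k == j)%:R)).
    by rewrite [leLHS]big_nat [leRHS]big_nat; apply: ler_sum => k; exact: step.
  rewrite big_split/= -/(tvar u r s) -/v !sumrB big_split/= !sum_nat_indic; [|lia..].
  by move=> /le_trans; apply; lra.
- have step k : (r <= k < s)%N -> (c k.+1 != c k)%:R <=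
      1 * (k == r)%:R + 1 * (k == s.-1)%:R + 1 * (k == i)%:R + 1 * (k == j)%:R :> R.
    move=> /andP[rk ks]; rewrite !mul1r -!natrD ler_nat.
    case: eqP => //= /eqP.
    have [ki|ki] := eqVneq k i; first by move=> _; lia.
    have [kj|kj] := eqVneq k j; first by move=> _; lia.
    have [kr|kr] := eqVneq k r; first by move=> _; lia.
    have [kss|kss] := eqVneq k s.-1; first by move=> _; lia.
    have [h|h] := boolP (i < k < j)%N; first by rewrite !cp ?eqxx; lia.
    by rewrite !cm ?eqxx; lia.
  have : \sum_(r <= k < s) (c k.+1 != c k)%:R <=
      \sum_(r <= k < s) (1 * (k == r)%:R + 1 * (k == s.-1)%:R
         + 1 * (k == i)%:R + 1 * (k == j)%:R) :> R.
    by rewrite [leLHS]big_nat [leRHS]big_nat; apply: ler_sum => k; exact: step.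
  rewrite !big_split/= !sum_nat_indic; [|lia..].
  by move=> /le_trans; apply; lra.
Qed.

(** On each side of the peak the increments of [u] have one sign, so the derivative of the variation
    telescopes to differences of [u - c], which vanish at [r], at the peak and at [s]. *)
Lemma coarsening_unimodal (R : realFieldType) (B : R) (u : nat -> R) r s k :
  (forall t, (r <= t <= s)%N -> `|u t| <= B) -> 3 * tvar u r s <= B -> 0 <= u r ->
  (r <= k <= s)%N ->
  (forall j, (r <= j < k)%N -> u j <= u j.+1) ->
  (forall j, (k <= j < s)%N -> u j.+1 <= u j) -> exists c, coarsening B u r s c.
Proof.
move=> uB vB ur /andP[rk ks] up dn.
have rs : (r <= s)%N by exact: leq_trans ks.
set v := tvar u r s in vB *.
have v0 : 0 <= v by exact: tvar_ge0.
have dv a b : (r <= a <= s)%N -> (r <= b <= s)%N -> `|u a - u b| <= v by exact: dist_le_tvar.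
have upr t : (r <= t <= k)%N -> u r <= u t.
  elim: t => [|t IH] /andP[rt tk]; first by have -> : r = 0%N by lia.
  move: rt; rewrite leq_eqVlt => /predU1P[->//|]; rewrite ltnS => rt.
  by rewrite (le_trans (IH _)) ?up; lia.
have upk t : (r <= t <= k)%N -> u t <= u k.
  move=> /andP[rt]; elim: (k) up => [|k' IH] up'; first by rewrite leqn0 => /eqP->.
  rewrite leq_eqVlt => /predU1P[->//|]; rewrite ltnS => tk.
  rewrite (le_trans (IH _ tk)) ?up' ?leqnn ?(leq_trans rt tk)//.
  by move=> j /andP[rj jk]; rewrite up'// rj ltnS ltnW.
have dns t : (k <= t <= s)%N -> u s <= u t.
  move=> /andP[kt]; elim: (s) dn => [|s' IH] dn'; first by rewrite leqn0 => /eqP->.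
  rewrite leq_eqVlt => /predU1P[->//|]; rewrite ltnS => ts.
  rewrite (le_trans _ (IH _ ts)) ?dn' ?leqnn ?(leq_trans kt ts)//.
  by move=> j /andP[kj js]; rewrite dn'// kj ltnS ltnW.
have dnk t : (k <= t <= s)%N -> u t <= u k.
  elim: t => [|t IH] /andP[kt ts]; first by have -> : k = 0%N by lia.
  move: kt; rewrite leq_eqVlt => /predU1P[<-//|]; rewrite ltnS => kt.
  by rewrite (le_trans _ (IH _)) ?dn; lia.
have umax t : (r <= t <= s)%N -> u t <= u k.
  by move=> /andP[rt ts]; have [tk|kt] := leqP t k; [apply: upk|apply: dnk]; lia.
(* On each side [c t] depends on the value [u t] only: where [u] is flat, [c] must be flat too,
   since [dabs 0 b] is the full [|b|]. *)
pose c t := if (t <= k)%N then (if u t == u r then u r else u k)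
            else (if u t == u s then u s else u k).
have ck : c k = u k by rewrite /c leqnn; case: eqP.
have cl t : (t <= k)%N -> c t = if u t == u r then u r else u k by rewrite /c => ->.
have cg t : (k <= t)%N -> c t = if u t == u s then u s else u k.
  rewrite leq_eqVlt => /predU1P[<-|kt]; first by rewrite ck; case: eqP.
  by rewrite /c leqNgt kt.
have cr : c r = u r by rewrite cl// eqxx.
have cs : c s = u s by rewrite cg// eqxx.
have cE t : c t = u t \/ c t = u k.
  by rewrite /c; case: ifP => _; case: eqP => [->|_]; [left|right|left|right].
have kk : (r <= k <= s)%N by lia.
exists c; split=> //.
- by move=> t ht; case: (cE t) => ->; rewrite uB.
- move=> t ht; case: (cE t) => ->; first by rewrite subrr normr0 -/v; lra.
  by rewrite (le_trans (dv _ _ kk ht))// -/v; lra.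
- move=> t ht /(norm_eq_bound_top ur vB ht) utB.
  case: (cE t) => -> //; rewrite utB; apply/eqP; rewrite eq_le -{2}utB umax// andbT.
  by have := uB _ kk; rewrite ler_norml => /andP[].
- rewrite (big_cat_nat rk ks)/=.
  have -> : \sum_(r <= i < k) dabs (u i.+1 - u i) (c i.+1 - c i) =
      \sum_(r <= i < k) ((u i.+1 - c i.+1) - (u i - c i)).
    apply: eq_big_nat => i /andP[ri ik]; rewrite !cl ?(ltnW ik)// /dabs.
    have [/subr0_eq ->|ui] := eqVneq (u i.+1 - u i) 0.
      by case: eqP => _; rewrite !subrr normr0.
    have uii : 0 < u i.+1 - u i by rewrite lt_def ui subr_ge0 up ?ri.
    by rewrite gtr0_norm// gtr0_sg//; ring.
  have -> : \sum_(k <= i < s) dabs (u i.+1 - u i) (c i.+1 - c i) =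
      \sum_(k <= i < s) ((c i.+1 - u i.+1) - (c i - u i)).
    apply: eq_big_nat => i /andP[ki si]; rewrite !cg ?(leqW ki)// /dabs.
    have [/subr0_eq ->|ui] := eqVneq (u i.+1 - u i) 0.
      by case: eqP => _; rewrite !subrr normr0.
    have uii : u i.+1 - u i < 0 by rewrite lt_neqAle ui subr_le0 dn ?ki.
    by rewrite ltr0_norm// ltr0_sg//; ring.
  by rewrite !telescope_sumr// ck cr cs !subrr addr0.
- rewrite (big_cat_nat rk ks)/=.
  (* By monotonicity, the indicator of [u i != u r] switches on at most once, exactly when [c]
     jumps, so counting jumps telescopes; after the peak the same holds with [u s]. *)
  have h1 : \sum_(r <= i < k) (c i.+1 != c i)%:R <=
      \sum_(r <= i < k) ((u i.+1 != u r)%:R - (u i != u r)%:R) :> R.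
    rewrite [leLHS]big_nat [leRHS]big_nat; apply: ler_sum => i /andP[ri ik].
    rewrite !cl ?(ltnW ik)//; have ui := up i; rewrite ri ik in ui.
    have := upr i; rewrite ri (ltnW ik) => /(_ isT).
    have [eq|neq] := eqVneq (u i) (u r) => uri.
      rewrite /= mulr0n subr0 ler_nat.
      by case: (eqVneq (u i.+1) (u r)) => _ /=; [rewrite eqxx|case: (_ != _)].
    have /negbTE -> : u i.+1 != u r.
      by rewrite gt_eqF// (lt_le_trans _ (ui isT))// lt_def neq.
    by rewrite eqxx subrr.
  have h2 : \sum_(k <= i < s) (c i.+1 != c i)%:R <=
      \sum_(k <= i < s) (- (u i.+1 != u s)%:R - - (u i != u s)%:R) :> R.
    rewrite [leLHS]big_nat [leRHS]big_nat; apply: ler_sum => i /andP[ki si].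
    rewrite !cg ?(leqW ki)//; have ui := dn i; rewrite ki si in ui.
    have := dns i.+1; rewrite (leqW ki) si => /(_ isT).
    have [eq|neq] := eqVneq (u i.+1) (u s) => usi.
      rewrite /= mulr0n oppr0 add0r opprK ler_nat.
      by case: (eqVneq (u i) (u s)) => _ /=; [rewrite eqxx|case: (_ != _)].
    have /negbTE -> : u i != u s.
      by rewrite gt_eqF// (lt_le_trans _ (ui isT))// lt_def neq.
    by rewrite eqxx opprK addNr.
  move: h1 h2; rewrite !telescope_sumr// !eqxx.
  by case: (u k != u r); case: (u k != u s) => /=; lra.
Qed.

(** Reflection [u |-> - u] reduces to [0 <= u r], where only the upper wall matters. *)
Lemma exists_coarsening (R : realFieldType) (B : R) (u : nat -> R) r s : (r <= s)%N ->
  (forall t, (r <= t <= s)%N -> `|u t| <= B) -> 3 * tvar u r s <= B ->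
  exists c, coarsening B u r s c.
Proof.
move=> rs uB vB; wlog ur : u uB vB / 0 <= u r => [hwlog|].
  have [|/ltW ur] := leP 0 (u r); first exact: hwlog.
  have [|||c hc] := hwlog (fun t => - u t); last by exists (fun t => - c t); exact: coarseningN.
  - by move=> t ht; rewrite normrN uB.
  - by rewrite tvarN.
  - by rewrite oppr_ge0.
have [[i [j [ri ij ui uj pl]]]|[k rks [up dn]]] := valley_or_unimodal u rs.
  exact: (coarsening_valley uB vB ur ri ij ui uj pl).
exact: (coarsening_unimodal uB vB ur rks up dn).
Qed.

(** * Least squares under a total variation budget *)

(** Yields one perturbation size that serves finitely many constraints at once. *)
Lemma uniform_small (R : realDomainType) (P : nat -> R -> Prop) (r s : nat) :
  (forall k, (r <= k <= s)%N -> exists2 e, 0 < e & forall x, 0 < x <= e -> P k x) ->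
  exists2 e, 0 < e & forall k, (r <= k <= s)%N -> forall x, 0 < x <= e -> P k x.
Proof.
elim: s => [|s IH] h.
  have [r0|r0] := leqP r 0.
    have [|e e0 he] := h 0%N; first by rewrite r0.
    by exists e => // k /andP[_]; rewrite leqn0 => /eqP->; exact: he.
  by exists 1 => // k; lia.
have [|e e0 he] := IH; first by move=> k hk; apply: h; lia.
have [rs|rs] := leqP r s.+1; last by exists 1 => // k; lia.
have [|e' e'0 he'] := h s.+1; first by rewrite rs leqnn.
exists (Num.min e e') => [|k /andP[rk]]; first by rewrite lt_min e0.
rewrite leq_eqVlt => /predU1P[-> x|ks x]; rewrite le_min => /and3P[x0 xe xe'].
  by apply: he'; rewrite x0.
by apply: he; rewrite ?x0//; lia.
Qed.

Definition tv_ball (R : numDomainType) (B T : R) (n : nat) (v : nat -> R) : Prop :=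
  (forall t, (1 <= t <= n)%N -> `|v t| <= B) /\ tvar v 1 n <= T.

Definition tv_optimal (R : numDomainType) (B T : R) (n : nat) (y u : nat -> R) : Prop :=
  tv_ball B T n u /\ forall v, tv_ball B T n v ->
    \sum_(1 <= t < n.+1) (u t - y t) ^+ 2 <= \sum_(1 <= t < n.+1) (v t - y t) ^+ 2.

(** Moving [u] away from [c] by a small [e] is feasible and changes the objective by
    [e * (e * Q - 2 * S)]. Optimality gives [2 * S <= e * Q] for all small [e], hence [S <= 0]. *)
Lemma tv_optimal_coarsening (R : realFieldType) (B T : R) n (y u : nat -> R) r s c :
  tv_optimal B T n y u -> (1 <= r)%N -> (r <= s)%N -> (s <= n)%N ->
  coarsening B u r s c ->
  \sum_(r <= t < s.+1) (u t - y t) * (c t - u t) <= 0.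
Proof.
move=> [[uB uT] uopt] r1 rs sn [cl cr cb _ ce ct _].
pose w e t : R := if (r <= t <= s)%N then u t + e * (u t - c t) else u t.
(* Below [e1] no increment of [u] changes sign, so [dabs_step] computes the variation exactly. *)
have [|e1 e10 he1] := @uniform_small R (fun k e => e * `|(u k.+1 - u k) - (c k.+1 - c k)|
    <= `|u k.+1 - u k| \/ u k.+1 - u k = 0) r s.
  move=> k _; have [->|a0] := eqVneq (u k.+1 - u k) 0; first by exists 1 => //; right.
  set a := u k.+1 - u k in a0 *; set b := _ - c k.
  have d0 : 0 < `|a - b| + 1 by rewrite ltr_wpDl.
  exists (`|a| / (`|a - b| + 1)) => [|x /andP[x0]]; first by rewrite divr_gt0// normr_gt0.
  rewrite ler_pdivlMr// => h; left; apply: le_trans h.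
  by rewrite mulrDr mulr1 lerDl ltW.
(* Below [e2] the box is respected: points on its boundary do not move, because [c = u] there, and
   the others have slack. *)
have [|e2 e20 he2] := @uniform_small R (fun t e => `|u t + e * (u t - c t)| <= B) r s.
  move=> t ht; have htn : (1 <= t <= n)%N by lia.
  have [utB|utB] := eqVneq `|u t| B.
    by exists 1 => // x _; rewrite (ce t ht utB) subrr mulr0 addr0 utB.
  have ltB : `|u t| < B by rewrite lt_neqAle utB uB.
  have d0 : 0 < `|u t - c t| + 1 by rewrite ltr_wpDl.
  exists ((B - `|u t|) / (`|u t - c t| + 1)) => [|x /andP[x0]].
    by rewrite divr_gt0// subr_gt0.
  rewrite ler_pdivlMr// => h; apply: le_trans (ler_normD _ _) _.
  by rewrite normrM (gtr0_norm x0); lra.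
have wball e : 0 < e <= Num.min e1 e2 -> tv_ball B T n (w e).
  rewrite le_min => /and3P[e0 ee1 ee2]; split.
    move=> t ht; rewrite /w; case: ifP => hrs; last exact: uB.
    by apply: he2; rewrite ?e0.
  apply: le_trans uT.
  rewrite (@tvar_cat _ _ 1 r n) ?r1 ?(leq_trans rs sn)// (@tvar_cat _ _ r s n) ?rs//.
  rewrite [leRHS](@tvar_cat _ _ 1 r n) ?r1 ?(leq_trans rs sn)//.
  rewrite [tvar u r n](@tvar_cat _ _ r s n) ?rs//.
  have wr : w e r = u r by rewrite /w cl subrr mulr0 addr0; case: ifP.
  have ws : w e s = u s by rewrite /w cr subrr mulr0 addr0; case: ifP.
  have wl t : (t <= r)%N -> w e t = u t.
    rewrite leq_eqVlt => /predU1P[->//|tr]; rewrite /w.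
    by have -> : (r <= t <= s)%N = false by lia.
  have wg t : (s <= t)%N -> w e t = u t.
    rewrite leq_eqVlt => /predU1P[<-//|tr]; rewrite /w.
    by have -> : (r <= t <= s)%N = false by lia.
  have -> : tvar (w e) 1 r = tvar u 1 r.
    by apply: eq_big_nat => k /andP[_ kr]; rewrite !wl// ltnW.
  have -> : tvar (w e) s n = tvar u s n.
    by apply: eq_big_nat => k /andP[sk _]; rewrite !wg// leqW.
  rewrite lerD2l lerD2r.
  have -> : tvar (w e) r s = tvar u r s +
      e * \sum_(r <= k < s) dabs (u k.+1 - u k) (c k.+1 - c k).
    rewrite mulr_sumr -big_split; apply: eq_big_nat => k /andP[rk ks] /=.
    rewrite -dabs_step//; last by apply: he1; rewrite ?e0//; lia.
    rewrite /w; have -> : (r <= k.+1 <= s)%N by lia.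
    have -> : (r <= k <= s)%N by lia.
    by congr `|_|; ring.
  by rewrite gerDl mulr_ge0_le0// ltW.
set S := \sum_(r <= t < s.+1) _.
set Q := \sum_(r <= t < s.+1) (u t - c t) ^+ 2.
have Q0 : 0 <= Q by apply: sumr_ge0 => t _; exact: sqr_ge0.
have key e : 0 < e <= Num.min e1 e2 -> 2 * S <= e * Q.
  move=> he; have /andP[e0 _] := he.
  have := uopt _ (wball _ he); rewrite -subr_ge0 -sumrB.
  have sn1 : (s.+1 <= n.+1)%N by [].
  rewrite (big_cat_nat (n := r)) ?(leq_trans rs (leqW sn))//=.
  rewrite (big_cat_nat (m := r) (n := s.+1)) ?(leqW rs)//=.
  rewrite big_nat big1 ?add0r; last first.
    move=> t /andP[_ tr]; rewrite /w; have -> : (r <= t <= s)%N = false by lia.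
    by rewrite subrr.
  rewrite [X in _ + X]big_nat [X in _ + X]big1 ?addr0; last first.
    move=> t /andP[st _]; rewrite /w; have -> : (r <= t <= s)%N = false by lia.
    by rewrite subrr.
  have -> : \sum_(r <= t < s.+1) ((w e t - y t) ^+ 2 - (u t - y t) ^+ 2) =
      e * (e * Q - 2 * S).
    rewrite /Q /S !mulr_sumr -sumrB mulr_sumr; apply: eq_big_nat => t /andP[rt ts].
    rewrite /w; have -> : (r <= t <= s)%N by lia.
    by ring.
  by rewrite pmulr_rge0// subr_ge0.
have m0 : 0 < Num.min e1 e2 by rewrite lt_min e10.
rewrite leNgt; apply/negP => S0.
have Q1 : 0 < Q + 1 by rewrite ltr_wpDl.
(* If [S > 0], this [e] gives [e * Q <= S < 2 * S]; the [+ 1] keeps the quotient meaningful when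
   [Q = 0]. *)
have := key (Num.min (Num.min e1 e2) (S / (Q + 1))).
rewrite lt_min m0 divr_gt0// ge_min lexx => /(_ isT).
apply/negP; rewrite -ltNge.
have : Num.min (Num.min e1 e2) (S / (Q + 1)) * Q <= S / (Q + 1) * (Q + 1).
  by apply: ler_pM; rewrite ?ge_min ?lexx ?orbT ?lerDl// le_min !ltW// divr_gt0.
by rewrite divfK ?gt_eqF// => h; apply: le_lt_trans h _; lra.
Qed.

(** * From constant comparators to the least-squares optimum: pieces and greedy bins *)

(** The induction keeps the start [q] of the current constant piece; each jump pays for the piece
    that it closes, and the [1] pays for the last piece. *)
Lemma sum_pieces_le (R : realDomainType) (g : nat -> R -> R) (B A : R) r s (c : nat -> R) :
  (forall a b z, (r <= a)%N -> (a <= b)%N -> (b <= s)%N -> `|z| <= B ->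
     \sum_(a <= t < b.+1) g t z <= A) ->
  (r <= s)%N -> (forall t, (r <= t <= s)%N -> `|c t| <= B) ->
  \sum_(r <= t < s.+1) g t (c t) <= A * (1 + \sum_(r <= k < s) (c k.+1 != c k)%:R).
Proof.
move=> gA rs cB.
suff [q [/andP[rq qs] cq hq]] : exists q, [/\ (r <= q <= s)%N,
    forall t, (q <= t <= s)%N -> c t = c q &
    \sum_(r <= t < q) g t (c t) <= A * \sum_(r <= k < s) (c k.+1 != c k)%:R].
  rewrite (big_cat_nat (n := q)) ?(leqW qs)//= mulrDr mulr1 addrC lerD//.
  rewrite big_nat; under eq_bigr => t ht do rewrite cq//.
  by rewrite -big_nat; apply: gA; rewrite ?cB ?rq.
elim: s rs gA cB => [|s IH] rs gA cB.
  exists r; split; [lia|by move=> t ht; congr c; lia|].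
  by rewrite !big_geq// mulr0.
move: rs; rewrite leq_eqVlt => /predU1P[<-|]; last rewrite ltnS => rs.
  exists r; split; [lia|by move=> t ht; congr c; lia|].
  by rewrite !big_geq// mulr0.
have [||q [/andP[rq qs] cq hq]] := IH rs.
- by move=> a b z ra ab bs; apply: gA => //; exact: leqW.
- by move=> t ht; apply: cB; lia.
rewrite big_nat_recr//=.
have [eqc|neqc] := eqVneq (c s.+1) (c s).
  exists q; split; [lia| |by rewrite /= mulr0n addr0].
  move=> t ht; have [->|ts] := eqVneq t s.+1; last by apply: cq; lia.
  by rewrite eqc cq ?qs ?leqnn.
exists s.+1; split; [lia|by move=> t ht; congr c; lia|].
rewrite (big_cat_nat (n := q)) ?(leqW qs)//= mulrDr mulr1 lerD//.
rewrite big_nat; under eq_bigr => t ht do rewrite cq//.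
by rewrite -big_nat; apply: gA; rewrite ?cB ?rq ?leqW.
Qed.

(** A bin grows while its cost is at most 1. The edge that overflows it is charged to the closed
    bin, so closed bins have disjoint costs above 1 each; the [1] pays for the last, open bin. *)
Lemma greedy_sum_le (R : realDomainType) (e F : nat -> R) (A : R) r n :
  (forall k, 0 <= e k) -> 0 <= A -> (r <= n)%N ->
  (forall a b, (r <= a)%N -> (a <= b)%N -> (b <= n)%N ->
     \sum_(a <= k < b) e k <= 1 -> \sum_(a <= t < b.+1) F t <= A) ->
  \sum_(r <= t < n.+1) F t <= A * (1 + \sum_(r <= k < n) e k).
Proof.
move=> e0 A0 rn FA.
suff [q [/andP[rq qn] eq hq]] : exists q, [/\ (r <= q <= n)%N,
    \sum_(q <= k < n) e k <= 1 &
    \sum_(r <= t < q) F t <= A * \sum_(r <= k < q) e k].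
  rewrite (big_cat_nat (n := q)) ?(leqW qn)//= mulrDr mulr1 addrC lerD//.
    exact: FA.
  apply: le_trans hq _; apply: ler_wpM2l => //.
  by rewrite [leRHS](big_cat_nat (n := q))//= lerDl sumr_ge0.
elim: n rn FA => [|n IH] rn FA.
  exists r; split; [lia| |by rewrite !big_geq// mulr0].
  by rewrite big_geq.
move: rn; rewrite leq_eqVlt => /predU1P[<-|]; last rewrite ltnS => rn.
  exists r; split; [lia| |by rewrite !big_geq// mulr0].
  by rewrite big_geq.
have [|q [/andP[rq qn] eq hq]] := IH rn.
  by move=> a b ra ab bn; apply: FA => //; exact: leqW.
have [le1|gt1] := leP (\sum_(q <= k < n.+1) e k) 1; first by exists q; split=> //; lia.
exists n.+1; split; [lia|by rewrite big_geq|].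
rewrite (big_cat_nat (n := q)) ?(leqW qn)//= [in leRHS](big_cat_nat (n := q)) ?(leqW qn)//=.
rewrite mulrDr lerD//.
apply: (@le_trans _ _ A); first by apply: FA => //; exact: leqW.
by rewrite ler_peMr// ltW.
Qed.

Lemma regret_tv_optimal (R : realFieldType) (B T A theta : R) n (x y u : nat -> R) :
  0 <= B -> 0 <= A -> 0 < theta ->
  (forall r s z, (1 <= r)%N -> (r <= s)%N -> (s <= n)%N -> `|z| <= B ->
     \sum_(r <= t < s.+1) ((x t - y t) ^+ 2 - (z - y t) ^+ 2) <= A) ->
  tv_optimal B T n y u ->
  \sum_(1 <= t < n.+1) ((x t - y t) ^+ 2 - (u t - y t) ^+ 2) <=
    (5 * A + 18) * (1 + n%:R / theta ^+ 2 + (theta + 3 / B) * T).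
Proof.
move=> B0 A0 th0 xA uopt.
have [[uB uT] _] := uopt.
have th2 : 0 <= (theta ^+ 2)^-1 by rewrite invr_ge0 sqr_ge0.
have thB : 0 <= theta + 3 / B by rewrite addr_ge0 ?divr_ge0// ltW.
have A5 : 0 <= 5 * A + 18 by lra.
have T0 : 0 <= T by apply: le_trans uT; exact: tvar_ge0.
have [->|n0] := posnP n.
  by rewrite big_geq// mulr_ge0// mul0r addr0 addr_ge0// mulr_ge0.
(* Cost at most 1 on a bin bounds its length by [theta ^+ 2] and its variation by [1 / theta], hence
   [(s - r) * v ^+ 2 <= 1]; the term [3 / B] enforces [3 * v <= B]. *)
pose e k := (theta ^+ 2)^-1 + (theta + 3 / B) * `|u k.+1 - u k|.
have sume a b : (a <= b)%N ->
    \sum_(a <= k < b) e k = (b - a)%:R / theta ^+ 2 + (theta + 3 / B) * tvar u a b.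
  by move=> ab; rewrite /e big_split/= sumr_const_nat -mulr_sumr  -[_ *+ (b - a)]mulr_natl.
apply: (@le_trans _ _ ((5 * A + 18) * (1 + \sum_(1 <= k < n) e k))); last first.
  apply: ler_wpM2l => //; rewrite sume// -addrA lerD2l lerD ?ler_wpM2l//.
  by apply: ler_wpM2r => //; rewrite ler_nat leq_subr.
apply: greedy_sum_le => // [k|r s r1 rs sn]; first by rewrite addr_ge0// mulr_ge0.
rewrite sume// => cost1.
set v := tvar u r s in cost1.
have v0 : 0 <= v by exact: tvar_ge0.
have usB t : (r <= t <= s)%N -> `|u t| <= B by move=> ht; apply: uB; lia.
have c0 : 0 <= (s - r)%:R / theta ^+ 2 by rewrite mulr_ge0.
have tv0 : 0 <= theta * v by rewrite mulr_ge0// ltW.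
have Bv0 : 0 <= 3 / B * v by rewrite mulr_ge0// divr_ge0.
have vB : 3 * v <= B.
  (* For [B = 0] the quotient [3 / B] is 0 and the cost does not compare [v] with [B], but then the
     box is a point and [v = 0]. *)
  move: B0; rewrite le_eqVlt => /predU1P[B0|B0].
    have u0 t : (r <= t <= s)%N -> u t = 0.
      by move=> /usB; rewrite -B0 normr_le0 => /eqP.
    rewrite /v /tvar big_nat big1 ?mulr0 -?B0// => k hk.
    by rewrite !u0 ?subrr ?normr0//; lia.
  have : 3 / B * v <= 1 by lra.
  by rewrite mulrAC ler_pdivrMr// mul1r.
have [c hc] := exists_coarsening rs usB vB.
have first_order := tv_optimal_coarsening uopt r1 rs sn hc.
have [_ _ cB cdist _ _ cj] := hc.
(* Three parts: static regret on at most five pieces, [5 * A]; the second-order loss, at most 18;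
   and the first-order term, nonpositive by optimality. *)
have -> : \sum_(r <= t < s.+1) ((x t - y t) ^+ 2 - (u t - y t) ^+ 2) =
    \sum_(r <= t < s.+1) ((x t - y t) ^+ 2 - (c t - y t) ^+ 2)
    + \sum_(r <= t < s.+1) (c t - u t) ^+ 2
    + 2 * \sum_(r <= t < s.+1) (u t - y t) * (c t - u t).
  by rewrite mulr_sumr -!big_split/=; apply: eq_bigr => t _; ring.
have h1 : \sum_(r <= t < s.+1) ((x t - y t) ^+ 2 - (c t - y t) ^+ 2) <= 5 * A.
  apply: le_trans (sum_pieces_le (g := fun t z => (x t - y t) ^+ 2 - (z - y t) ^+ 2)
    (B := B) (A := A) _ rs cB) _.
    by move=> a b z ra ab bs; apply: xA => //; [exact: leq_trans ra|exact: leq_trans sn].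
  by rewrite mulrC ler_wpM2r//; lra.
have h2 : \sum_(r <= t < s.+1) (c t - u t) ^+ 2 <= 18.
  apply: (@le_trans _ _ (\sum_(r <= t < s.+1) 9 * v ^+ 2)).
    rewrite [leLHS]big_nat [leRHS]big_nat; apply: ler_sum => t ht.
    have := cdist t; rewrite -ltnS ht => /(_ isT) h.
    rewrite -(real_normK (num_real (c t - u t))).
    have -> : 9 * v ^+ 2 = (3 * v) ^+ 2 by ring.
    by rewrite -(@ler_pXn2r _ 2%N) ?nnegrE// in h; rewrite mulr_ge0.
  rewrite sumr_const_nat subSn//.
  have -> : 9 * v ^+ 2 *+ (s - r).+1 = 9 * v ^+ 2 + 9 * ((s - r)%:R * v ^+ 2).
    by rewrite -natr1 -mulr_natl -natr1; ring.
  (* A bin has one point more than edges. The extra [9 * v ^+ 2] is covered by a second copy of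
     [9 * (s - r) * v ^+ 2 <= 9], or vanishes for a single point, where [v = 0]. *)
  have [sr|sr] := posnP (s - r)%N.
    have -> : v = 0 by rewrite /v /tvar big_geq// -subn_eq0 sr.
    by rewrite sr; lra.
  have : (s - r)%:R * v ^+ 2 <= 1.
    have -> : (s - r)%:R * v ^+ 2 = (s - r)%:R / theta ^+ 2 * (theta * v) ^+ 2.
      by field; rewrite gt_eqF.
    by apply: mulr_ile1; rewrite ?sqr_ge0// ?exprn_ile1//; lra.
  have : v ^+ 2 <= (s - r)%:R * v ^+ 2.
    by rewrite ler_peMl ?sqr_ge0// ler1n.
  lra.
lra.
Qed.

(** * Existence of the constrained least-squares optimum *)

Lemma continuous_sum_seq (R : realType) (S : topologicalType) (s : seq nat)
    (F : nat -> S -> R) :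
  (forall k, continuous (F k)) -> continuous (fun v : S => \sum_(k <- s) F k v).
Proof.
move=> Fc; elim: s => [|k s IH] v.
  by under eq_fun do rewrite big_nil; exact: cvg_cst.
by under eq_fun do rewrite big_cons; apply: cvgD; [exact: Fc|exact: IH].
Qed.

Lemma continuous_sqrB (R : realType) (a : R) : continuous (fun z : R => (z - a) ^+ 2).
Proof.
move=> z; under eq_fun do rewrite expr2.
by apply: cvgM; (apply: cvgB; [exact: cvg_id|exact: cvg_cst]).
Qed.

(** Tychonoff makes the sequences in the box compact for the product topology; the variation and the
    objective involve finitely many coordinates and are continuous. *)
Lemma tv_optimal_exists (R : realType) (B T : R) n (y w : nat -> R) :
  0 <= B -> tv_ball B T n w -> exists u, tv_optimal B T n y u.
Proof.
move=> B0 wT.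
pose V := prod_topology (fun _ : nat => R).
have ev t : continuous (fun v : V => v t : R) by exact: (@proj_continuous nat (fun=> R) t).
pose Q := [set v : V | forall t, `[- B, B]%classic (v t)] `&` [set v : V | tvar v 1 n <= T].
have Qc : compact Q.
  have cQ := @tychonoff nat (fun=> R) (fun=> `[- B, B]%classic) (fun=> @segment_compact R _ _).
  apply: (compact_closedI cQ).
  have dc k : continuous (fun v : V => `|v k.+1 - v k| : R).
    by move=> v; exact: (cvg_norm (cvgB (ev k.+1 v) (ev k v))).
  have /continuous_closedP tvc := continuous_sum_seq (s := index_iota 1 n) dc.
  exact: (tvc _ (@closed_le R T)).
(* The compact set constrains every coordinate, [tv_ball] only those in [1..n]; zero fills in the
   rest. *)
pose trunc (v : nat -> R) : V := fun t => if (1 <= t <= n)%N then v t else 0.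
have truncE v t : (1 <= t <= n)%N -> trunc v t = v t by rewrite /trunc => ->.
have truncQ v : tv_ball B T n v -> Q (trunc v).
  move=> [vB vT]; split=> [t|] /=.
    rewrite in_itv/= -ler_norml /trunc; case: ifP => [/vB//|_].
    by rewrite normr0.
  rewrite (le_trans _ vT)// le_eqVlt; apply/orP; left; apply/eqP.
  by apply: eq_big_nat => k hk; rewrite !truncE//; lia.
pose F (v : V) : R := \sum_(1 <= t < n.+1) (v t - y t) ^+ 2.
have Fc : continuous F.
  apply: (continuous_sum_seq (F := fun t (v : V) => (v t - y t) ^+ 2)) => t v.
  exact: (@continuous_comp V R R (fun v => v t) (fun z => (z - y t) ^+ 2) v (ev t v)
    (@continuous_sqrB R (y t) _)).
have [|u] := compact_EVT_min _ Qc (continuous_subspaceT Fc).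
  by exists (trunc w); exact: truncQ.
rewrite inE => -[uB uT] umin; exists u; split.
  by split=> // t _; have := uB t; rewrite /= in_itv/= -ler_norml.
move=> v vT; have := umin (trunc v); rewrite inE => /(_ (truncQ _ vT)).
move=> /le_trans; apply; rewrite le_eqVlt; apply/orP; left; apply/eqP.
by apply: eq_big_nat => t ht; rewrite truncE.
Qed.

(** * Univariate FLH-OGD *)

(** The quotient of the two sides is [g b] with [g 0 = 1]. Between 0 and [b] one has [|a - x| <= 1],
    so the derivative of [g] has the sign of [x] and [g] is least at 0. *)
Lemma expR_tangent_unit (R : realType) (a b : R) :
  `|a| <= 1 -> `|a - b| <= 1 -> expR (a * b - b ^+ 2 / 2) <= 1 + a * b.
Proof.
move=> a1 ab1.
pose g (x : R) : R := (1 + a * x) * expR (x ^+ 2 / 2 - a * x).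
pose dg (x : R) : R := x * (1 - a * (a - x)) * expR (x ^+ 2 / 2 - a * x).
have gd (x : R) : is_derive x (1 : R) g (dg x).
  rewrite /g /dg; apply: is_derive_eq.
  by rewrite /GRing.scale /=; field.
have gc (A : set R) : {within A, continuous g}.
  apply: continuous_subspaceT => x; apply: differentiable_continuous.
  by apply/derivable1_diffP; exact: ex_derive.
have a2 : -1 <= a <= 1 by rewrite -ler_norml.
have ab2 : -1 <= a - b <= 1 by rewrite -ler_norml.
have fac (x : R) : `|a - x| <= 1 -> 0 <= 1 - a * (a - x).
  move=> h; have : a * (a - x) <= 1; last by lra.
  by apply: le_trans (ler_norm _) _; rewrite normrM mulr_ile1.
have g0 : g 0 = 1 by rewrite /g !mulr0 addr0 expr0n/= mul0r subr0 expR0 mulr1.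
have g1 : 1 <= g b.
  have [b0|b0] := leP 0 b.
    have [x] := MVT_segment b0 (fun x _ => gd x) (gc _).
    rewrite in_itv/= => /andP[x0 xb]; rewrite g0 subr0 => e.
    have : 0 <= dg x * b.
      rewrite /dg; apply: mulr_ge0 => //; apply: mulr_ge0; last exact: expR_ge0.
      by apply: mulr_ge0 => //; apply: fac; rewrite ler_norml; lra.
    by rewrite -e; lra.
  have [x] := MVT_segment (ltW b0) (fun x _ => gd x) (gc _).
  rewrite in_itv/= => /andP[xb x0]; rewrite g0 sub0r => e.
  have : 0 <= dg x * b.
    rewrite /dg mulrC mulrA; apply: mulr_ge0; last exact: expR_ge0.
    rewrite mulrA; apply: mulr_ge0; first by rewrite mulr_le0// ltW.
    by apply: fac; rewrite ler_norml; lra.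
  by move: e; rewrite mulrN => e; lra.
have -> : a * b - b ^+ 2 / 2 = - (b ^+ 2 / 2 - a * b) by ring.
by rewrite expRN -[leLHS]mul1r ler_pdivrMr ?expR_gt0.
Qed.

(* Tangent-line form of the concavity of [p |-> exp (- (y - p)^2 / (2 D^2))] on
   [|y - p| <= D], i.e. of the exp-concavity of the squared loss. *)
Lemma expR_sq_tangent (R : realType) (D y p q : R) :
  0 < D -> `|y - p| <= D -> `|y - q| <= D ->
  expR (- (1 / (2 * D ^+ 2)) * (y - q) ^+ 2) <=
  expR (- (1 / (2 * D ^+ 2)) * (y - p) ^+ 2) * (1 + (y - p) * (q - p) / D ^+ 2).
Proof.
move=> D0 yp yq.
have h : expR ((y - p) / D * ((q - p) / D) - ((q - p) / D) ^+ 2 / 2) <=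
    1 + (y - p) / D * ((q - p) / D).
  apply: expR_tangent_unit; rewrite -?mulrBl normrM normfV (gtr0_norm D0).
    by rewrite ler_pdivrMr// mul1r.
  by rewrite ler_pdivrMr// mul1r; have -> : y - p - (q - p) = y - q by ring.
have -> : - (1 / (2 * D ^+ 2)) * (y - q) ^+ 2 =
    - (1 / (2 * D ^+ 2)) * (y - p) ^+ 2 +
    ((y - p) / D * ((q - p) / D) - ((q - p) / D) ^+ 2 / 2).
  by field; rewrite gt_eqF.
rewrite expRD; apply: ler_wpM2l; first exact: expR_ge0.
apply: le_trans h _; rewrite le_eqVlt; apply/orP; left; apply/eqP.
by field; rewrite gt_eqF.
Qed.

Lemma clamp_range (R : realType) (B x : R) : 0 <= B -> `|clamp B x| <= B.
Proof.
move=> B0; rewrite /clamp ler_norml le_max lexx/= ge_max ge_min lexx /=.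
by rewrite andbT; lra.
Qed.

Lemma clamp_dist (R : realType) (B x u : R) :
  `|u| <= B -> (clamp B x - u) ^+ 2 <= (x - u) ^+ 2.
Proof.
rewrite ler_norml => /andP[h1 h2]; rewrite /clamp.
have [xB|xB] := leP B x.
  have [_|] := leP (- B) B; last by lra.
  rewrite -subr_ge0.
  have -> : (x - u) ^+ 2 - (B - u) ^+ 2 = (x - B) * ((x - u) + (B - u)) by ring.
  by apply: mulr_ge0; lra.
have [Bx|Bx] := leP (- B) x; first by [].
rewrite -subr_ge0.
have -> : (x - u) ^+ 2 - (- B - u) ^+ 2 = (- B - x) * ((u - x) + (u + B)) by ring.
by apply: mulr_ge0; lra.
Qed.

Section FLH.
Variables (R : realType) (B x0 D : R) (y : nat -> R).

(** One learner run on a given label sequence. Index [k] holds the state at time [k + 1], hence the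
    [t.-1] below; [D] bounds the distance from the labels to the box and stands for
    [2 * B + Ginf / H]. *)
Fixpoint ustates (k : nat) : ustate R :=
  if k is k'.+1 then uupd B (1 / (2 * D ^+ 2)) x0 k (ustates k') (y k) else uinit x0.

Definition uplay (t : nat) : R := upred t (ustates t.-1).

Hypotheses (B0 : 0 <= B) (x0B : `|x0| <= B) (D0 : 0 < D).

Lemma ustates_pos k j : `|upos (ustates k) j| <= B.
Proof.
by elim: k => [|k IH] //=; case: ifP => // _; exact: clamp_range.
Qed.

Lemma ustates_weight k :
  (forall j, (1 <= j <= k.+1)%N -> 0 < uw (ustates k) j) /\
  \sum_(1 <= j < k.+2) uw (ustates k) j = 1.
Proof.
elim: k => [|k [IH1 IH2]].
  split=> [j hj|]; last by rewrite big_nat1.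
  by have -> : j = 1%N by lia.
rewrite /=; set Z := \sum_(1 <= j < k.+2) _.
have Z0 : 0 < Z.
  rewrite /Z big_nat_recl//= ltr_wpDr//; last by rewrite mulr_gt0 ?expR_gt0 ?IH1.
  rewrite big_nat; apply: sumr_ge0 => i hi.
  by rewrite mulr_ge0 ?expR_ge0// ltW// IH1; lia.
have k2 : 0 < 1 - 1 / k.+2%:R :> R.
  by rewrite subr_gt0 ltr_pdivrMr ?ltr0n// mul1r ltr1n.
split=> [j hj|].
  case: ifP => jk.
    by rewrite mulr_gt0// divr_gt0// mulr_gt0 ?expR_gt0// IH1; lia.
  by have -> : (j == k.+2)%N by lia; rewrite divr_gt0 ?ltr0n.
rewrite big_nat_recr//= ltnn eqxx.
rewrite big_nat; under eq_bigr => i hi.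
  have -> : (i <= k.+1)%N by lia.
  over.
rewrite -big_nat -mulr_sumr -mulr_suml -/Z divff ?gt_eqF// mulr1.
by rewrite subrK.
Qed.

Lemma uplay_range t : (1 <= t)%N -> `|uplay t| <= B.
Proof.
case: t => // t _; have [w0 w1] := ustates_weight t.
rewrite /uplay /upred /= (le_trans (ler_norm_sum _ _ _))//.
rewrite -[leRHS]mul1r -w1 mulr_suml [leLHS]big_nat [leRHS]big_nat.
apply: ler_sum => j hj; rewrite normrM gtr0_norm ?w0; [|lia..].
by rewrite ler_wpM2l ?ustates_pos// ltW// w0; lia.
Qed.

Hypothesis yD : forall t p, (1 <= t)%N -> `|p| <= B -> `|y t - p| <= D.

(** Jensen by tangent lines at the prediction: the linear terms average out because [uplay t] is the
    weighted mean of the positions. *)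
Lemma mix_loss t : (1 <= t)%N ->
  \sum_(1 <= j < t.+1) uw (ustates t.-1) j *
     expR (- (1 / (2 * D ^+ 2)) * (y t - upos (ustates t.-1) j) ^+ 2) <=
  expR (- (1 / (2 * D ^+ 2)) * (y t - uplay t) ^+ 2).
Proof.
case: t => // t _; have [w0 w1] := ustates_weight t.
set s := ustates t in w0 w1 *; rewrite /=.
set E := expR (- (1 / (2 * D ^+ 2)) * (y t.+1 - uplay t.+1) ^+ 2).
apply: (@le_trans _ _ (\sum_(1 <= j < t.+2) uw s j *
   (E * (1 + (y t.+1 - uplay t.+1) * (upos s j - uplay t.+1) / D ^+ 2)))).
  rewrite [leLHS]big_nat [leRHS]big_nat; apply: ler_sum => j hj.
  rewrite ler_wpM2l//; first by rewrite ltW// w0; lia.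
  by apply: expR_sq_tangent; rewrite ?yD// ?uplay_range// ustates_pos.
have -> : \sum_(1 <= j < t.+2) uw s j *
   (E * (1 + (y t.+1 - uplay t.+1) * (upos s j - uplay t.+1) / D ^+ 2)) =
   E * (1 - (y t.+1 - uplay t.+1) / D ^+ 2 * uplay t.+1) * (\sum_(1 <= j < t.+2) uw s j) +
   E * ((y t.+1 - uplay t.+1) / D ^+ 2) * (\sum_(1 <= j < t.+2) uw s j * upos s j).
  clearbody E; move: (uplay t.+1) => X.
  by rewrite !mulr_sumr -big_split/=; apply: eq_bigr => j _; ring.
rewrite w1 -/(upred t.+1 s) -/(uplay t.+1) le_eqVlt; apply/orP; left; apply/eqP; ring.
Qed.

(** The update multiplies the weight by [t / (t + 1)], which the [ln t] in the potential cancels,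
    and by [E / Z], where [mix_loss] bounds the normalizer [Z]. The factor [2 * D ^+ 2] is the
    inverse learning rate. *)
Lemma meta_step t r : (1 <= r <= t)%N ->
  (uplay t - y t) ^+ 2 - (upos (ustates t.-1) r - y t) ^+ 2 <=
  2 * D ^+ 2 * ((ln (uw (ustates t) r) + ln t.+1%:R) -
                (ln (uw (ustates t.-1) r) + ln t%:R)).
Proof.
case: t => [|t] hr; first by lia.
have [w0 w1] := ustates_weight t.
have wr : 0 < uw (ustates t) r by apply: w0; lia.
have := @mix_loss t.+1 isT; rewrite /=.
set Z := \sum_(1 <= j < t.+2) _ => hZ.
have rt : (r <= t.+1)%N by lia.
rewrite rt.
set E := expR (- (1 / (2 * D ^+ 2)) * (y t.+1 - upos (ustates t) r) ^+ 2).
have Z0 : 0 < Z.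
  rewrite /Z (bigD1_seq r) ?iota_uniq ?mem_index_iota//=.
  rewrite ltr_wpDr ?mulr_gt0 ?expR_gt0// big_seq_cond sumr_ge0// => i.
  rewrite mem_index_iota => /andP[hi _].
  by rewrite mulr_ge0 ?expR_ge0// ltW// w0; lia.
have t1 : 0 < t.+1%:R :> R by rewrite ltr0n.
have t2 : 0 < t.+2%:R :> R by rewrite ltr0n.
have -> : 1 - 1 / t.+2%:R = t.+1%:R / t.+2%:R :> R.
  have -> : t.+1%:R = t.+2%:R - 1 :> R by rewrite -[t.+2%:R]natr1 addrK.
  by move: (t.+2%:R) t2 => a a0; field; rewrite gt_eqF.
have E0 : 0 < E by exact: expR_gt0.
rewrite !lnM ?posrE ?divr_gt0 ?mulr_gt0 ?invr_gt0// !lnV ?posrE//.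
rewrite /E expRK.
have : ln Z <= - (1 / (2 * D ^+ 2)) * (y t.+1 - uplay t.+1) ^+ 2.
  by rewrite -[leRHS]expRK ler_ln ?posrE ?expR_gt0.
move=> h; have D2 : 0 < 2 * D ^+ 2 by rewrite mulr_gt0// exprn_gt0.
set L := ln (uw (ustates t) r); rewrite -(ler_pM2l D2) in h.
have e1 (a : R) : 2 * D ^+ 2 * (- (1 / (2 * D ^+ 2)) * a) = - a.
  by field; rewrite gt_eqF.
rewrite e1 in h.
have -> : 2 * D ^+ 2 * (ln t.+1%:R - ln t.+2%:R + (L + - (1 / (2 * D ^+ 2)) *
   (y t.+1 - upos (ustates t) r) ^+ 2 - ln Z) + ln t.+2%:R - (L + ln t.+1%:R)) =
   2 * D ^+ 2 * (- (1 / (2 * D ^+ 2)) * (y t.+1 - upos (ustates t) r) ^+ 2)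
   - 2 * D ^+ 2 * ln Z by ring.
by rewrite e1; lra.
Qed.

(** The potential telescopes. It is 0 at time [r], when learner [r] has weight [1 / r], and at most
    [ln (s + 1)] at the end, since weights are at most 1. *)
Lemma meta_regret r s : (1 <= r <= s)%N ->
  \sum_(r <= t < s.+1) ((uplay t - y t) ^+ 2 - (upos (ustates t.-1) r - y t) ^+ 2) <=
  2 * D ^+ 2 * ln s.+1%:R.
Proof.
move=> /andP[r1 rs].
pose Phi t := ln (uw (ustates t.-1) r) + ln t%:R.
apply: (@le_trans _ _ (\sum_(r <= t < s.+1) 2 * D ^+ 2 * (Phi t.+1 - Phi t))).
  rewrite [leLHS]big_nat [leRHS]big_nat; apply: ler_sum => t ht.
  by apply: meta_step; lia.
rewrite -mulr_sumr telescope_sumr ?(leqW rs)// /Phi.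
rewrite ler_wpM2l ?mulr_ge0 ?(ltW D0)//.
have -> : uw (ustates r.-1) r = r%:R^-1.
  case: (r) r1 => [//|[|r'] _] /=; first by rewrite invr1.
  by rewrite ltnn eqxx div1r.
rewrite lnV ?posrE ?ltr0n// addNr subr0 gerDr.
have [w0 w1] := ustates_weight s.
have rS : (1 <= r <= s.+1)%N by lia.
rewrite ln_le0//= -w1 (bigD1_seq r) ?iota_uniq ?mem_index_iota//= lerDl.
rewrite big_seq_cond sumr_ge0// => i.
by rewrite mem_index_iota => /andP[hi _]; rewrite ltW// w0.
Qed.

Lemma harmonic_le m : \sum_(1 <= k < m.+1) k%:R^-1 <= 1 + ln m.+1%:R :> R.
Proof.
(* One more term with the same bound: this form starts with equality at [m = 0] and its step is
   [ln (1 - x) <= - x]. *)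
suff : \sum_(1 <= k < m.+2) k%:R^-1 <= 1 + ln m.+1%:R :> R.
  by apply: le_trans; rewrite [leRHS]big_nat_recr//= lerDl invr_ge0.
elim: m => [|m IH]; first by rewrite big_nat1 invr1 ln1 addr0.
rewrite big_nat_recr//= (le_trans (lerD IH (lexx _)))// -addrA lerD2l.
have m1 : 0 < m.+1%:R :> R by rewrite ltr0n.
have m2 : 0 < m.+2%:R :> R by rewrite ltr0n.
have := @le_ln1Dx R (- m.+2%:R^-1).
have -> : 1 - m.+2%:R^-1 = m.+1%:R / m.+2%:R :> R.
  have -> : m.+1%:R = m.+2%:R - 1 :> R by rewrite -[m.+2%:R]natr1 addrK.
  by move: (m.+2%:R) m2 => a a0; field; rewrite gt_eqF.
rewrite ltrN2 invf_lt1// ltr1n => /(_ isT).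
by rewrite ln_div ?posrE// lerBlDr => h; rewrite -lerBrDr [leRHS]addrC.
Qed.

Lemma ogd_regret r s z : (1 <= r <= s)%N -> `|z| <= B ->
  \sum_(r <= t < s.+1) ((upos (ustates t.-1) r - y t) ^+ 2 - (z - y t) ^+ 2) <=
  D ^+ 2 * (1 + ln s.+1%:R).
Proof.
move=> /andP[r1 rs] zB.
pose p t := upos (ustates t.-1) r.
(* The squared loss satisfies [(p - y)^2 - (z - y)^2 = 2 (p - z)(p - y) - (p - z)^2]. With step
   [1 / (2 tau)], the last square turns the weight [tau] into [tau - 1], so [Psi] telescopes from
   [Psi r = 0] and leaves a harmonic sum. *)
pose Psi t : R := (t - r)%:R * (p t - z) ^+ 2.
apply: (@le_trans _ _ (\sum_(r <= t < s.+1) ((D ^+ 2 / (t - r).+1%:R) - (Psi t.+1 - Psi t)))).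
  rewrite [leLHS]big_nat [leRHS]big_nat; apply: ler_sum => t /andP[rt ts].
  rewrite -/(p t) /Psi subSn//.
  have pS : p t.+1 = clamp B (p t - 1 / (2 * (t - r).+1%:R) * (2 * (p t - y t))).
    by rewrite /p; case: (t) rt => [|t'] rt /=; [lia|rewrite rt].
  have t0 : 0 < (t - r).+1%:R :> R by rewrite ltr0n.
  have h := clamp_dist (p t - 1 / (2 * (t - r).+1%:R) * (2 * (p t - y t))) zB.
  rewrite -pS -(ler_pM2l t0) in h; move: h.
  have -> : (t - r).+1%:R *
      (p t - 1 / (2 * (t - r).+1%:R) * (2 * (p t - y t)) - z) ^+ 2 =
      (t - r).+1%:R * (p t - z) ^+ 2 - 2 * (p t - z) * (p t - y t)
      + (p t - y t) ^+ 2 / (t - r).+1%:R.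
    by field; rewrite gt_eqF.
  have : (p t - y t) ^+ 2 / (t - r).+1%:R <= D ^+ 2 / (t - r).+1%:R.
    rewrite ler_pM2r ?invr_gt0// -(real_normK (num_real (p t - y t))).
    rewrite ler_pXn2r ?nnegrE ?normr_ge0 ?(ltW D0)// distrC yD ?(leq_trans r1 rt)//.
    exact: ustates_pos.
  have -> : (t - r)%:R = (t - r).+1%:R - 1 :> R by rewrite -natr1; ring.
  move: (_ / _) (D ^+ 2 / _) => a b; lra.
rewrite sumrB telescope_sumr ?(leqW rs)//.
have -> : Psi r = 0 by rewrite /Psi subnn mul0r.
rewrite subr0 -mulr_sumr.
apply: (@le_trans _ _ (D ^+ 2 * \sum_(r <= t < s.+1) (t - r).+1%:R^-1)).
  by rewrite gerBl mulr_ge0// sqr_ge0.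
rewrite ler_wpM2l ?sqr_ge0//.
have -> : \sum_(r <= t < s.+1) (t - r).+1%:R^-1 = \sum_(1 <= k < (s - r).+2) k%:R^-1 :> R.
  rewrite -[in LHS](add0n r) big_addn subSn// [RHS]big_add1/=.
  by apply: eq_bigr => i _; rewrite addnK.
apply: le_trans (harmonic_le _) _; rewrite lerD2l ler_ln ?posrE ?ltr0n// ler_nat.
by lia.
Qed.

(** Passes through the base learner born at the left end [r] of the interval: meta regret against it
    plus its own regret. *)
Lemma flh_static_regret n r s z : (1 <= r)%N -> (r <= s)%N -> (s <= n)%N -> `|z| <= B ->
  \sum_(r <= t < s.+1) ((uplay t - y t) ^+ 2 - (z - y t) ^+ 2) <=
  3 * D ^+ 2 * (1 + ln (n%:R + 1)).
Proof.
move=> r1 rs sn zB; have rrs : (1 <= r <= s)%N by rewrite r1.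
have := lerD (meta_regret rrs) (ogd_regret rrs zB); rewrite -big_split/=.
under eq_bigr do rewrite subrKA.
move=> /le_trans; apply.
have : ln s.+1%:R <= ln (n%:R + 1) :> R.
  by rewrite natr1 ler_ln ?posrE ?ltr0n// ler_nat.
have : 0 <= ln s.+1%:R :> R by rewrite ln_ge0// ler1n.
have := sqr_ge0 D; set d := D ^+ 2; set a := ln _; set b := ln _ => d0 a0 ab.
have : d * a <= d * b by rewrite ler_wpM2l.
lra.
Qed.

End FLH.

(** * The coordinatewise scheme *)

Lemma flh_dynamic_regret (R : realType) (B x0 D theta : R) (y w : nat -> R) n :
  0 <= B -> `|x0| <= B -> 0 < D -> 0 < theta ->
  (forall t p, (1 <= t)%N -> `|p| <= B -> `|y t - p| <= D) ->
  (forall t, (1 <= t <= n)%N -> `|w t| <= B) ->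
  \sum_(1 <= t < n.+1) ((uplay B x0 D y t - y t) ^+ 2 - (w t - y t) ^+ 2) <=
  (15 * D ^+ 2 + 18) * (1 + ln (n%:R + 1)) *
    (1 + n%:R / theta ^+ 2 + (theta + 3 / B) * tvar w 1 n).
Proof.
move=> B0 x0B D0 th0 yD wB.
(* With the variation of [w] as budget, [w] is itself feasible, so [u] has no larger loss and may
   replace it. *)
have [u uopt] : exists u, tv_optimal B (tvar w 1 n) n y u.
  by apply: (tv_optimal_exists y B0 (w := w)); split.
have L0 : 0 <= ln (n%:R + 1) :> R by rewrite ln_ge0// lerDr.
have A0 : 0 <= 3 * D ^+ 2 * (1 + ln (n%:R + 1)).
  by rewrite !mulr_ge0 ?(ltW D0)// addr_ge0.
have h := regret_tv_optimal B0 A0 th0 (flh_static_regret B0 x0B D0 yD (n := n)) uopt.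
have [uT umin] := uopt; have hw : tv_ball B (tvar w 1 n) n w by split.
apply: le_trans (le_trans _ h) _; first by rewrite !sumrB lerD2l lerN2 umin.
apply: ler_wpM2r; last by nra.
rewrite !addr_ge0 ?divr_ge0 ?sqr_ge0// mulr_ge0 ?tvar_ge0// addr_ge0 ?(ltW th0)//.
by rewrite divr_ge0.
Qed.

(** The labels depend on the algorithm's own plays; once the realized labels are fixed, each
    coordinate is a univariate run, and the regret bounds hold for any label sequence in range. *)
Lemma cw_state_ustates (R : realType) d (B Ginf H : R) (x0 : 'rV[R]_d) fb k i :
  cw_state B Ginf H x0 fb k i =
  ustates B (x0 ord0 i) (2 * B + Ginf / H)
    (fun t => cw_x B Ginf H x0 fb t ord0 i - fb t (cw_x B Ginf H x0 fb t) ord0 i / H) k.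
Proof. by elim: k => //= k <-. Qed.

Lemma cw_x_uplay (R : realType) d (B Ginf H : R) (x0 : 'rV[R]_d) fb t i :
  cw_x B Ginf H x0 fb t ord0 i =
  uplay B (x0 ord0 i) (2 * B + Ginf / H)
    (fun t => cw_x B Ginf H x0 fb t ord0 i - fb t (cw_x B Ginf H x0 fb t) ord0 i / H) t.
Proof. by rewrite [LHS]mxE cw_state_ustates. Qed.

(** * Norms, the distance penalty and the surrogate loss *)

Lemma coord_le_linf (R : realType) d (x : 'rV[R]_d) i : `|x ord0 i| <= linf x.
Proof. exact: le_bigmax. Qed.

Lemma linf_ge0 (R : realType) d (x : 'rV[R]_d) : 0 <= linf x.
Proof. exact: bigmax_ge_id. Qed.

Lemma linf_le (R : realType) d (x : 'rV[R]_d) (B : R) :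
  0 <= B -> (forall i, `|x ord0 i| <= B) -> linf x <= B.
Proof. by move=> B0 h; apply: bigmax_le. Qed.

Lemma l1_ge0 (R : realType) d (x : 'rV[R]_d) : 0 <= l1 x.
Proof. by apply: sumr_ge0. Qed.

Lemma l1D (R : realType) d (x y : 'rV[R]_d) : l1 (x + y) <= l1 x + l1 y.
Proof. by rewrite /l1 -big_split; apply: ler_sum => i _; rewrite mxE ler_normD. Qed.

Lemma l1Z_delta (R : realType) d (a : R) (i : 'I_d) :
  l1 (a *: delta_mx ord0 i : 'rV[R]_d) = `|a|.
Proof.
rewrite /l1 (bigD1 i)//= !mxE !eqxx mulr1 big1 ?addr0// => j /negbTE ji.
by rewrite !mxE ji andbF mulr0 normr0.
Qed.

Lemma dotp_delta (R : realType) d (g : 'rV[R]_d) (a : R) (i : 'I_d) :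
  dotp g (a *: delta_mx ord0 i) = a * g ord0 i.
Proof.
rewrite /dotp (bigD1 i)//= !mxE !eqxx mulr1 big1 ?addr0 1?mulrC// => j /negbTE ji.
by rewrite !mxE ji andbF !mulr0.
Qed.

Lemma dotp_ge (R : realType) d (g x : 'rV[R]_d) : - (linf g * l1 x) <= dotp g x.
Proof.
rewrite /l1 mulr_sumr -sumrN; apply: ler_sum => i _.
have : `|g ord0 i * x ord0 i| <= linf g * `|x ord0 i|.
  by rewrite normrM ler_wpM2r// coord_le_linf.
by rewrite ler_norml => /andP[].
Qed.

Lemma Spen_lip (R : realType) d (W : set 'rV[R]_d) P (x y : 'rV[R]_d) :
  is_l1_proj W P -> Spen P y <= Spen P x + l1 (y - x).
Proof.
move=> hP; rewrite /Spen [leRHS]addrC.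
apply: le_trans ((hP y).2 (P x) (hP x).1) _.
by have := l1D (y - x) (x - P x); rewrite subrKA.
Qed.

(** The penalty is 1-Lipschitz in [l1]; the subgradient inequality is tested at plus and minus a
    unit vector. This yields the gradient bound [2 * G] for the surrogate. *)
Lemma Spen_subgrad_bound (R : realType) d (W : set 'rV[R]_d) P (x g : 'rV[R]_d) i :
  is_l1_proj W P -> is_subgrad (Spen P) x g -> `|g ord0 i| <= 1.
Proof.
move=> hP hg.
have h (a : R) : a * g ord0 i <= `|a|.
  have := hg (x + a *: delta_mx ord0 i); rewrite addrAC subrr add0r dotp_delta.
  have := Spen_lip x (x + a *: delta_mx ord0 i) hP; rewrite addrAC subrr add0r l1Z_delta.
  lra.
have := h 1; have := h (-1); rewrite normrN normr1 mul1r mulN1r => h1 h2.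
by rewrite ler_norml; lra.
Qed.

Lemma Spen_eq0 (R : realType) d (W : set 'rV[R]_d) P (w : 'rV[R]_d) :
  is_l1_proj W P -> W w -> Spen P w = 0.
Proof.
move=> hP Ww; apply/eqP; rewrite eq_le l1_ge0 andbT.
apply: le_trans ((hP w).2 w Ww) _.
by rewrite subrr /l1 big1// => i _; rewrite mxE normr0.
Qed.

(* Strong convexity at the projected point bounds the price of projecting by [G * Spen],
   which the surrogate already pays; completing the square in the strong convexity of the
   surrogate then turns its regret into a coordinatewise squared-loss regret. *)
Lemma surrogate_regret (R : realType) d (H G B : R) (W : set 'rV[R]_d) P
    (f : 'rV[R]_d -> R) (x w sg : 'rV[R]_d) :
  0 < H -> 0 <= G -> W `<=` @box R d B -> is_l1_proj W P -> strongly_convex_on H (@box R d B) f ->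
  (forall z, box B z -> linf (grad f z) <= G) -> is_subgrad (Spen P) x sg ->
  box B x -> W w ->
  f (P x) - f w <= H / 2 * \sum_(i < d)
    ((x ord0 i - (x ord0 i - (grad f x + G *: sg) ord0 i / H)) ^+ 2 -
     (w ord0 i - (x ord0 i - (grad f x + G *: sg) ord0 i / H)) ^+ 2).
Proof.
move=> H0 G0 WB hP fc fG hsg xB Ww.
have PB : box B (P x) by apply: WB; exact: (hP x).1.
have h1 : f (P x) <= f x + G * Spen P x.
  have := fc _ _ PB xB; have := dotp_ge (grad f (P x)) (x - P x).
  have : 0 <= H / 2 * l2sq (x - P x).
    by rewrite mulr_ge0 ?divr_ge0 ?(ltW H0)//; apply: sumr_ge0 => i _; exact: sqr_ge0.
  have : linf (grad f (P x)) * l1 (x - P x) <= G * Spen P x.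
    by rewrite ler_wpM2r ?l1_ge0// fG.
  lra.
have h2 := fc _ _ xB (WB _ Ww).
have h3 := hsg w; rewrite (Spen_eq0 hP Ww) in h3.
have h4 : G * Spen P x + G * dotp sg (w - x) <= 0.
  by rewrite -mulrDr -(mulr0 G) ler_wpM2l.
have -> : H / 2 * \sum_(i < d)
    ((x ord0 i - (x ord0 i - (grad f x + G *: sg) ord0 i / H)) ^+ 2 -
     (w ord0 i - (x ord0 i - (grad f x + G *: sg) ord0 i / H)) ^+ 2) =
   - dotp (grad f x) (w - x) - G * dotp sg (w - x) - H / 2 * l2sq (w - x).
  rewrite /dotp /l2sq !mulr_sumr -!sumrN -!big_split/=; apply: eq_bigr => i _.
  rewrite !mxE; move: ('D_ _ f x : R) => D; field.
  by rewrite gt_eqF.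
lra.
Qed.

Lemma box_sup (R : realType) d (W : set 'rV[R]_d) (B : R) :
  W !=set0 -> compact W -> B = sup [set linf w | w in W] -> 0 <= B /\ W `<=` @box R d B.
Proof.
move=> [w0 Ww0] Wc ->.
(* [sup] is an upper bound only for a set known to be bounded, which compactness supplies. *)
have ubW : has_ubound [set linf w | w in W].
  have [M [_ hM]] := compact_bounded Wc.
  exists (Num.max 0 M + 1) => _ [w Ww <-].
  apply: linf_le => [|i]; first by rewrite addr_ge0// le_max lexx.
  have : M < Num.max 0 M + 1.
    by rewrite (le_lt_trans (_ : _ <= Num.max 0 M)) ?ltrDl// le_max lexx orbT.
  move=> /hM/(_ w Ww); apply: le_trans.
  by rewrite [leRHS]/Num.norm/= mx_normrE (le_bigmax _ (fun ij => `|w ij.1 ij.2|) (ord0, i)).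
have WB w : W w -> linf w <= sup [set linf w | w in W].
  by move=> Ww; apply: ub_le_sup => //; exists w.
by split=> //; exact: le_trans (linf_ge0 w0) (WB _ Ww0).
Qed.

(** The chosen [theta] makes [d * n / theta ^+ 2] and [theta * T] both equal to
    [(d n)^(1/3) T^(2/3)]. The remaining [3 / B * T] is linear in [T]; the a priori bound on [T]
    trades a factor [T^(1/3)] for a multiple of [(d n)^(1/3)]. *)
Lemma balance_scale (R : realType) (B T C d n : R) :
  0 <= B -> 0 <= d -> 0 <= n -> 0 <= T <= C -> T <= 2 * B * (d * n) ->
  exists2 theta, 0 < theta &
    d + d * n / theta ^+ 2 + (theta + 3 / B) * T <=
    (3 + 3 / B * (2 * B) `^ (1 / 3)) *
      Num.max (d `^ (1 / 3) * n `^ (1 / 3) * C `^ (2 / 3)) d.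
Proof.
move=> B0 d0 n0 /andP[T0 TC] TB.
set M := Num.max _ _.
have dM : d <= M by rewrite le_max lexx orbT.
have k0 : 0 <= 3 / B * (2 * B) `^ (1 / 3) by rewrite mulr_ge0 ?divr_ge0 ?powR_ge0.
have M0 : 0 <= M by exact: le_trans dM.
have kM : 0 <= 3 / B * (2 * B) `^ (1 / 3) * M by rewrite mulr_ge0.
move: T0; rewrite le_eqVlt => /predU1P[T0|T0].
  (* Without variation any large scale will do; this one gives [d * n / theta ^+ 2 <= d]. *)
  exists (n + 1); first by rewrite ltr_wpDl.
  rewrite -T0 mulr0 addr0.
  have : d * n / (n + 1) ^+ 2 <= d.
    rewrite ler_pdivrMr ?exprn_gt0 ?ltr_wpDl//; apply: ler_wpM2l => //; nra.
  by rewrite mulrDl; lra.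
have dn0 : 0 <= d * n by rewrite mulr_ge0.
pose a := (d * n) `^ (1 / 3); pose b := T `^ (1 / 3).
have cube (z : R) : 0 <= z -> z = (z `^ (1 / 3)) ^+ 3.
  by move=> z0; rewrite -powR_mulrn ?powR_ge0// -powRrM mul1r mulVf// powRr1.
have Eb : T = b ^+ 3 by apply: cube; exact: ltW.
have Ea : d * n = a ^+ 3 by exact: cube.
have b0 : 0 < b by exact: powR_gt0.
have dn1 : 0 < d * n.
  rewrite lt_def dn0 andbT; apply/eqP => dn; move: TB; rewrite dn mulr0; lra.
have a0 : 0 < a by exact: powR_gt0.
have ba : b <= (2 * B) `^ (1 / 3) * a.
  rewrite -powRM ?mulr_ge0//; apply: ge0_ler_powR => //; rewrite ?nnegrE ?(ltW T0)//.
  by rewrite !mulr_ge0.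
have abM : a * b ^+ 2 <= M.
  rewrite le_max; apply/orP; left; rewrite /a powRM//.
  apply: ler_wpM2l; first by rewrite mulr_ge0 ?powR_ge0.
  rewrite -powR_mulrn ?powR_ge0// -powRrM.
  have -> : 1 / 3 * 2%:R = 2 / 3 :> R by lra.
  by apply: ge0_ler_powR => //; rewrite ?nnegrE ?(ltW T0)// (le_trans (ltW T0)).
exists (a / b); first exact: divr_gt0.
have -> : d * n / (a / b) ^+ 2 = a * b ^+ 2.
  by rewrite Ea; field; rewrite !gt_eqF.
have -> : (a / b + 3 / B) * T = a * b ^+ 2 + 3 / B * (b * b ^+ 2).
  transitivity ((a / b + 3 / B) * b ^+ 3); first by rewrite -Eb.
  by rewrite mulrDl; congr (_ + _); field; rewrite gt_eqF.
have : 3 / B * (b * b ^+ 2) <= 3 / B * (2 * B) `^ (1 / 3) * M.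
  rewrite -[leRHS]mulrA; apply: ler_wpM2l; first by rewrite divr_ge0.
  apply: (@le_trans _ _ ((2 * B) `^ (1 / 3) * a * b ^+ 2)).
    by apply: ler_wpM2r => //; exact: sqr_ge0.
  by rewrite -mulrA; apply: ler_wpM2l => //; exact: powR_ge0.
by rewrite mulrDl; lra.
Qed.

Theorem theorem2 (R : realType) (H G Bc : R) (hH : 0 < H) (hG : 0 < G) :
  exists (K : R) (p : nat),
  forall (d : nat) (W : set 'rV[R]_d) (B : R),
    W !=set0 -> compact W -> convex_set_rV W ->
    B = sup [set linf w | w in W] -> B = Bc ->
  forall (f : nat -> 'rV[R]_d -> R),
    (forall t x, box B x -> differentiable (f t) x) ->
    (forall t, strongly_convex_on H (box B) (f t)) ->
    (forall t x, box B x -> linf (grad (f t) x) <= G) ->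
  forall (P : 'rV[R]_d -> 'rV[R]_d), is_l1_proj W P ->
  forall (sg : nat -> 'rV[R]_d -> 'rV[R]_d),
    (forall t x, is_subgrad (Spen P) x (sg t x)) ->
  forall (x0 : 'rV[R]_d), box B x0 ->
  forall (n : nat) (C : R) (w : nat -> 'rV[R]_d),
    0 <= C ->
    (forall t, (1 <= t <= n)%N -> W (w t)) ->
    \sum_(2 <= t < n.+1) l1 (w t - w t.-1) <= C ->
    \sum_(1 <= t < n.+1) (f t (scheme_play B G H x0 f P sg t) - f t (w t))
      <= K * (1 + ln (n%:R + 1)) ^+ p *
         Num.max ((d%:R) `^ (1/3) * (n%:R) `^ (1/3) * C `^ (2/3)) d%:R.
Proof.
(* This is [2 * B + Ginf / H] with [Ginf = 2 * G]. In the constant, [H / 2] comes from completing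
   the square, [15 * D ^+ 2 + 18] from the cost of a bin and the last factor from balancing. *)
pose D : R := 2 * Bc + 2 * G / H.
exists (H / 2 * (15 * D ^+ 2 + 18) * (3 + 3 / Bc * (2 * Bc) `^ (1 / 3))), 1%N.
move=> d W B W0 Wc _ Bsup BBc f _ fc fG P hP sg hsg x0 x0B n C w C0 Ww wC.
have [B0 WB] := box_sup W0 Wc Bsup; subst Bc.
have D0 : 0 < D by rewrite ltr_wpDl ?mulr_ge0// divr_gt0// mulr_gt0.
set fb := surr_fb G f sg; set L := 1 + ln (n%:R + 1).
pose x t := cw_x B (2 * G) H x0 fb t.
pose y i t := x t ord0 i - fb t (x t) ord0 i / H.
have x0i i : `|x0 ord0 i| <= B by exact: le_trans (coord_le_linf _ _) x0B.
have xE t i : x t ord0 i = uplay B (x0 ord0 i) D (y i) t by exact: cw_x_uplay.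
have xi t i : (1 <= t)%N -> `|x t ord0 i| <= B.
  by move=> t1; rewrite xE; exact: uplay_range.
have xB t : (1 <= t)%N -> box B (x t) by move=> t1; apply: linf_le => // i; exact: xi.
have yD i t p : (1 <= t)%N -> `|p| <= B -> `|y i t - p| <= D.
  move=> t1 pB; have fbG : `|fb t (x t) ord0 i| <= 2 * G.
    rewrite /fb /surr_fb mxE [X in _ + X]mxE (le_trans (ler_normD _ _))//.
    have := le_trans (coord_le_linf _ i) (fG t _ (xB t t1)).
    have : `|G * sg t (x t) ord0 i| <= G.
      by rewrite normrM gtr0_norm// ler_piMr ?(ltW hG)// (Spen_subgrad_bound _ hP (hsg _ _)).
    lra.
  have : `|fb t (x t) ord0 i / H| <= 2 * G / H.
    by rewrite normrM normfV (gtr0_norm hH) ler_pM2r ?invr_gt0.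
  move: (xi t i t1) pB; rewrite /y /D !ler_norml; move: (_ / H) (2 * G / H) => u v.
  lra.
have wB i t : (1 <= t <= n)%N -> `|w t ord0 i| <= B.
  by move=> ht; apply: le_trans (coord_le_linf _ _) (WB _ (Ww _ ht)).
(* Coordinatewise variations add up to the [l1] path length, so the coordinates share the budget
   [C]. *)
pose T := \sum_(i < d) tvar (fun t => w t ord0 i) 1 n.
have TC : T <= C.
  apply: le_trans wC; rewrite big_add1/= /T /tvar exchange_big/=.
  by apply: ler_sum => k _; apply: ler_sum => i _; rewrite !mxE.
have T0 : 0 <= T by apply: sumr_ge0 => i _; exact: tvar_ge0.
have TB : T <= 2 * B * (d%:R * n%:R).
  apply: (@le_trans _ _ (\sum_(i < d) 2 * B * n%:R)); last first.
    by rewrite sumr_const card_ord -[leLHS]mulr_natl; lra.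
  apply: ler_sum => i _.
  apply: (@le_trans _ _ (\sum_(1 <= k < n) 2 * B)).
    rewrite /tvar [leLHS]big_nat [leRHS]big_nat; apply: ler_sum => k hk.
    have h1 := wB i k; have h2 := wB i k.+1.
    rewrite (le_trans (ler_normB _ _))//.
    have : `|w k ord0 i| <= B by apply: h1; lia.
    have : `|w k.+1 ord0 i| <= B by apply: h2; lia.
    lra.
  rewrite sumr_const_nat -[leLHS]mulr_natr ler_wpM2l ?mulr_ge0// ler_nat; lia.
(* The bound for each coordinate is affine in its variation, so a common [theta], tuned to the total
   [T], can be used in all of them and the bounds summed. *)
have [|theta th0 hth] := @balance_scale R B T C d%:R n%:R B0 (ler0n _ _) (ler0n _ _) _ TB.
  by rewrite T0.
have L0 : 0 <= ln (n%:R + 1) :> R by rewrite ln_ge0// lerDr.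
have A0 : 0 <= (15 * D ^+ 2 + 18) * L.
  by rewrite mulr_ge0 ?addr_ge0 ?mulr_ge0 ?(ltW D0).
have h1 : \sum_(1 <= t < n.+1) (f t (scheme_play B G H x0 f P sg t) - f t (w t)) <=
    \sum_(1 <= t < n.+1) H / 2 * \sum_(i < d)
      ((uplay B (x0 ord0 i) D (y i) t - y i t) ^+ 2 - (w t ord0 i - y i t) ^+ 2).
  rewrite [leLHS]big_nat [leRHS]big_nat; apply: ler_sum => t ht.
  have t1 : (1 <= t)%N by lia.
  have := surrogate_regret hH (ltW hG) WB hP (fc t) (fG t) (hsg t (x t)) (xB t t1) (Ww t ht).
  by under eq_bigr do rewrite {1}xE.
apply: le_trans h1 _.
set Kc := 3 + _ in hth *; set M := Num.max _ _ in hth *.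
have -> : H / 2 * (15 * D ^+ 2 + 18) * Kc * L ^+ 1 * M =
    H / 2 * ((15 * D ^+ 2 + 18) * L * (Kc * M)) by ring.
rewrite -mulr_sumr exchange_big/=; apply: ler_wpM2l; first by rewrite divr_ge0// ltW.
apply: (@le_trans _ _ (\sum_(i < d) (15 * D ^+ 2 + 18) * L *
    (1 + n%:R / theta ^+ 2 + (theta + 3 / B) * tvar (fun t => w t ord0 i) 1 n))).
  by apply: ler_sum => i _; apply: flh_dynamic_regret => //; [exact: yD|exact: wB].
rewrite -mulr_sumr; apply: ler_wpM2l => //; apply: le_trans hth.
by rewrite big_split/= -mulr_sumr -/T sumr_const card_ord -[_ *+ d]mulr_natl mulrDr mulr1 mulrA.
Qed.
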